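(* Let $N\in\mathbb N$, $m\in\mathbb N_0$, $\sigma\in(0,1]$, and $s=m+\sigma>0$. Then for every $k\in\{0,\dots,2m+1\}$ the function $\mathbb R^N\ni x\mapsto(x_1)_+^{k+\sigma-1}$ is $s$-harmonic in $\mathbb R^N_+$, i.e. its image under $(-\Delta)^s$ vanishes at every point of $\mathbb R^N_+$.
   Context: $\mathbb R^N_+:=\{x\in\mathbb R^N:x_1>0\}$. For $a\in\mathbb R$, $(x_1)_+^a:=x_1^a$ if $x_1>0$ and $:=0$ if $x_1\le0$ (also if $a\le0$). If $\sigma=1$, $(-\Delta)^s=(-\Delta)^{m+1}$ is the iterated Laplacian $\big(-\sum_i\partial_i^2\big)^{m+1}$. If $\sigma\in(0,1)$, $$(-\Delta)^su(x):=\frac{c_{N,s}}2\int_{\mathbb R^N}\frac{\sum_{k=-m-1}^{m+1}(-1)^k\binom{2m+2}{m+1-k}u(x+ky)}{|y|^{N+2s}}\,dy,\qquad c_{N,s}:=\frac{4^s\Gamma(\frac N2+s)}{\pi^{N/2}\Gamma(-s)}\Big(\sum_{k=1}^{m+1}(-1)^k\binom{2m+2}{m+1-k}k^{2s}\Big)^{-1},$$ which is well defined at points of an open set $U$ for functions that are locally $C^{2s+\alpha}$ in $U$ for some $\alpha>0$ and satisfy $\int_{\mathbb R^N}\frac{|u(x)|}{1+|x|^{N+2s}}dx<\infty$. *)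

(* Defs.v *)
From HB Require Import structures.
From mathcomp Require Import all_boot all_order all_algebra.
From mathcomp Require Import all_classical all_reals all_analysis.

Set Implicit Arguments.
Unset Strict Implicit.
Unset Printing Implicit Defensive.

Import Order.TTheory GRing.Theory Num.Theory.
Import numFieldNormedType.Exports.

Local Open Scope classical_set_scope.
Local Open Scope ring_scope.

(* R^n is ['rV[R]_n], with the product sigma-algebra of the Borel sets of R,
   i.e. the one generated by the n coordinate maps. *)
Definition rV_display : measure_display.
Proof. exact: default_measure_display. Qed.

Section measurable_rV.
Context {R : realType} (n : nat).

Let coord : 'I_n -> 'rV[R]_n -> measurableTypeR R := fun i v => v 0 i.

Let rV_set0 : g_sigma_preimage coord set0.
Proof. exact: sigma_algebra0. Qed.

Let rV_setC A : g_sigma_preimage coord A -> g_sigma_preimage coord (~` A).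
Proof. exact: sigma_algebraC. Qed.

Let rV_bigcup (F : _^nat) : (forall i, g_sigma_preimage coord (F i)) ->
  g_sigma_preimage coord (\bigcup_i (F i)).
Proof. exact: sigma_algebra_bigcup. Qed.

HB.instance Definition _ := @isMeasurable.Build rV_display
  'rV[R]_n (g_sigma_preimage coord) rV_set0 rV_setC rV_bigcup.

End measurable_rV.

Lemma measurable_coord (R : realType) n (i : 'I_n) :
  measurable_fun [set: 'rV[R]_n] (fun v => v 0 i : measurableTypeR R).
Proof.
move=> _ Y mY; rewrite setTI; apply: sub_sigma_algebra => /=.
rewrite -bigcup_seq/=; exists i => /=; first by rewrite mem_index_enum.
by exists Y => //; rewrite setTI.
Qed.

Lemma measurable_fun_rV (R : realType) d (T : measurableType d) n
    (f : T -> 'rV[R]_n) :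
  (forall i, measurable_fun setT (fun t => f t 0 i : measurableTypeR R)) ->
  measurable_fun setT f.
Proof.
move=> mf _ A mA; rewrite setTI.
suff : (fun B => measurable (f @^-1` B)) A by [].
move: A mA; apply: smallest_sub.
  split=> [|B mB|F mF].
  - by rewrite preimage_set0.
  - by rewrite setTD preimage_setC; exact: measurableC.
  - by rewrite preimage_bigcup; exact: bigcup_measurable.
move=> B; rewrite -bigcup_seq/= => -[i _ [C mC <-]].
rewrite setTI -comp_preimage -[X in measurable X]setTI.
exact: (mf i).
Qed.

Definition cons_rV (R : realType) n (p : measurableTypeR R * 'rV[R]_n) :
  'rV[R]_n.+1 := \row_i if unlift ord0 i is Some j then p.2 0 j else p.1.

Definition uncons_rV (R : realType) n (v : 'rV[R]_n.+1) :
  measurableTypeR R * 'rV[R]_n := (v 0 ord0, \row_j v 0 (lift ord0 j)).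

Lemma cons_rVK (R : realType) n : cancel (@cons_rV R n) (@uncons_rV R n).
Proof.
move=> [x w]; congr pair; first by rewrite mxE unlift_none.
by apply/rowP => j; rewrite !mxE liftK.
Qed.

Lemma measurable_cons_rV (R : realType) n :
  measurable_fun setT (@cons_rV R n).
Proof.
apply: measurable_fun_rV => i; rewrite /cons_rV.
under eq_fun do rewrite mxE.
case: (unlift ord0 i) => [j|]; last exact: measurable_fst.
exact: (measurableT_comp (measurable_coord j) measurable_snd).
Qed.

Lemma measurable_uncons_rV (R : realType) n :
  measurable_fun setT (@uncons_rV R n).
Proof.
apply/measurable_fun_pairP; split; first exact: measurable_coord.
apply: measurable_fun_rV => i; rewrite /uncons_rV /=.
under eq_fun do rewrite mxE.
exact: measurable_coord.
Qed.

Section prod_rV.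
Context {R : realType} {n : nat}.

Definition prod_rV (mu : set 'rV[R]_n -> \bar R) : set 'rV[R]_n.+1 -> \bar R :=
  pushforward (@lebesgue_measure R \x mu)%E (@cons_rV R n).

Variable mu : {sigma_finite_measure set 'rV[R]_n -> \bar R}.

HB.instance Definition _ := Measure.copy (prod_rV mu)
  (measure_function_pushforward__canonical__measure_function_Measure
    (@lebesgue_measure R \x mu)%E (@measurable_cons_rV R n)).

Let prod_rV_sigma_finite : sigma_finite setT (prod_rV mu).
Proof.
have /sigma_finiteP[F [FT ndF Foo]] := sigma_finiteT (@lebesgue_measure R).
have /sigma_finiteP[G [GT ndG Goo]] := sigma_finiteT mu.
exists (fun k => @uncons_rV R n @^-1` (F k `*` G k)).
  rewrite -preimage_bigcup -[LHS](preimage_setT (@uncons_rV R n)).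
  congr (_ @^-1` _); apply/seteqP; split => // -[x y] _.
  have [i _ Fx] : (\bigcup_i F i) x by rewrite -FT.
  have [j _ Gy] : (\bigcup_j G j) y by rewrite -GT.
  exists (maxn i j) => //; split => /=.
    by move: x Fx; exact/subsetPset/ndF/leq_maxl.
  by move: y Gy; exact/subsetPset/ndG/leq_maxr.
move=> k; have [mF Fk] := Foo k; have [mG Gk] := Goo k.
have mFG : measurable (F k `*` G k) by exact: measurableX.
split; first by rewrite -[X in measurable X]setTI; exact: measurable_uncons_rV.
rewrite /prod_rV /pushforward -comp_preimage.
rewrite (_ : _ \o _ = id) ?preimage_id; last first.
  by apply/funext => p; exact: cons_rVK.
by rewrite product_measure1E// lte_mul_pinfty// ge0_fin_numE.
Qed.

HB.instance Definition _ := Measure_isSigmaFinite.Build _ _ _ (prod_rV mu)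
  prod_rV_sigma_finite.

End prod_rV.

(* n-dimensional Lebesgue measure: the n-fold product of [lebesgue_measure]. *)
Fixpoint lebesgue_rV (R : realType) n :
    {sigma_finite_measure set 'rV[R]_n -> \bar R} :=
  if n is n'.+1 then prod_rV (@lebesgue_rV R n') else \d_(0 : 'rV[R]_0).

Lemma lebesgue_rV_box (R : realType) n (A : 'I_n -> set (measurableTypeR R)) :
  (forall i, measurable (A i)) ->
  lebesgue_rV R n [set v | forall i, A i (v 0 i)] =
  (\prod_(i < n) lebesgue_measure (A i))%E.
Proof.
elim: n A => [|n IH] A mA.
  rewrite big_ord0 /= diracE mem_set//= => -[].
  by [].
have mB : measurable [set w : 'rV[R]_n | forall i, A (lift ord0 i) (w 0 i)].
  rewrite (_ : [set _ | _] = \bigcap_(i in [set: 'I_n])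
      ((fun w : 'rV_n => w 0 i : measurableTypeR R) @^-1` A (lift ord0 i))); last first.
    by apply/seteqP; split => [w Aw i _|w Aw i]; exact: Aw.
  apply: fin_bigcap_measurable => // i _.
  by rewrite -[X in measurable X]setTI; exact: measurable_coord.
rewrite big_ord_recl -IH => [|i]; last exact: mA.
rewrite /= /prod_rV /pushforward -product_measure1E//.
congr product_measure1; apply/seteqP; split => [[x w] /= Aw|[x w] /= [Ax Aw] i].
  split; first by have := Aw ord0; rewrite mxE unlift_none.
  by move=> i; have := Aw (lift ord0 i); rewrite mxE liftK.
by rewrite mxE; case: unliftP => [j ->|->].
Qed.

Definition enorm (R : realType) N (y : 'rV[R]_N) : R :=
  Num.sqrt (\sum_(i < N) y 0 i ^+ 2).

(* Euler's integral, extended to nonpositive non-integers by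
   Gamma (z + 1) = z * Gamma z. *)
Definition Gamma (R : realType) (z : R) : R :=
  let G (a : R) := \int[lebesgue_measure]_(t in `]0, +oo[)
                     (t `^ (a - 1) * expR (- t)) in
  let n := if 0 < z then 0%N else (Num.truncn (- z)).+1 in
  G (z + n%:R) / \prod_(i < n) (z + i%:R).

Definition laplacian (R : realType) N (u : 'rV[R]_N -> R) (x : 'rV[R]_N) : R :=
  \sum_(i < N) 'D_(delta_mx 0 i) ('D_(delta_mx 0 i) u) x.

Definition poly_laplacian (R : realType) N (j : nat) (u : 'rV[R]_N -> R) :
    'rV[R]_N -> R :=
  iter j (fun v x => - laplacian v x) u.

Definition fractional_const (R : realType) (N m : nat) (sigma : R) : R :=
  let s := m%:R + sigma in
  (4 `^ s * Gamma (N%:R / 2 + s)) / (pi `^ (N%:R / 2) * Gamma (- s)) *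
  (\sum_(1 <= k < m.+2)
     (-1) ^+ k * 'C((2 * m).+2, m.+1 - k)%:R * k%:R `^ (2 * s))^-1.

(* The index k of the sum over -m-1 <= k <= m+1 is j - (m + 1). *)
Definition central_difference (R : realType) N (m : nat) (u : 'rV[R]_N -> R)
    (x y : 'rV[R]_N) : R :=
  \sum_(j < (2 * m).+3)
    let k := j%:Z - m.+1%:Z in
    (-1) ^ k * 'C((2 * m).+2, `|m.+1%:Z - k|%N)%:R * u (x + k%:~R *: y).

Definition fractional_integrand (R : realType) N (m : nat) (sigma : R)
    (u : 'rV[R]_N -> R) (x y : 'rV[R]_N) : R :=
  central_difference m u x y / enorm y `^ (N%:R + 2 * (m%:R + sigma)).

(* (-Delta)^s for s = m + sigma with 0 < sigma <= 1. *)
Definition fraclap (R : realType) N (m : nat) (sigma : R)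
    (u : 'rV[R]_N -> R) (x : 'rV[R]_N) : R :=
  if sigma == 1 then poly_laplacian m.+1 u x
  else fractional_const N m sigma / 2 *
       \int[lebesgue_rV R N]_y fractional_integrand m sigma u x y.

(* ['D_v f x] and [\int] are total, with a default value when the limit or the
   Lebesgue integral does not exist; this rules out the default values. *)
Definition fraclap_defined (R : realType) N (m : nat) (sigma : R)
    (u : 'rV[R]_N -> R) (x : 'rV[R]_N) : Prop :=
  if sigma == 1 then
    \forall y \near x, forall (j : 'I_m.+1) (i : 'I_N),
      derivable (poly_laplacian j u) y (delta_mx 0 i) /\
      derivable ('D_(delta_mx 0 i) (poly_laplacian j u)) y (delta_mx 0 i)
  else
    (lebesgue_rV R N).-integrable setT
      (fun y => (fractional_integrand m sigma u x y)%:E).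

Definition s_harmonic_in (R : realType) N (m : nat) (sigma : R)
    (U : set 'rV[R]_N) (u : 'rV[R]_N -> R) : Prop :=
  forall x, U x -> fraclap_defined m sigma u x /\ fraclap m sigma u x = 0.

Definition half_space (R : realType) n : set 'rV[R]_n.+1 :=
  [set x | 0 < x 0 ord0].

(* The truncation is explicit because [0 `^ 0 = 1] and, for t < 0, [t `^ a]
   has the junk value 1. *)
Definition pos_power (R : realType) (t a : R) : R :=
  if 0 < t then t `^ a else 0.

(* Main.v *)
Require Import Defs.
From mathcomp Require Import all_boot all_order all_algebra.
From mathcomp Require Import all_classical all_reals all_analysis.
From mathcomp Require Import measurable_realfun.
From mathcomp Require Import ring lra zify.

(** For sigma = 1 the function is the polynomial x_1^k near each point of the
half space, and m + 1 Laplacians lower its degree k <= 2m + 1 below zero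
([polyharmonic_case]).

Let sigma < 1, s = m + sigma, a = k + sigma - 1, and write x for the first
coordinate of the point.  The difference in the numerator only involves the
first coordinate t of y, so integrating out the other ones, which by scaling
turns |y|^(-N-2s) into a multiple of |t|^(-1-2s) ([integral_radial_kernel]),
leaves the integral over the line of F(t) |t|^(-1-2s), where
F(t) = sum_j w_j (x + c_j t)_+^a has the nodes c_j = -m-1, ..., m+1 and
alternating binomial weights w_j.  The weights kill all moments of order less
than 2m + 2, so F(t) = O(t^(2m+2)) at 0 ([difference_moment_bound]); as a < 2s
the integral converges, and F is even, so only t > 0 matters.

The single terms of F are not integrable at 0.  Cut the integral off at e > 0
and set J(c, a, q) = int_e^oo (x + c t)_+^a t^(-q) dt.  The derivative of
(x + c t)^a t^(-q) yields two identities with the same boundary term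
B = (x + c e)^a e^(-q):
  - q J(c, a, q + 1) = a c J(c, a - 1, q) + B  ([power_tail_parts]),
  - (q - a) J(c, a, q + 1) + a x J(c, a - 1, q + 1) = B
    ([power_tail_recurrence]).
Weighted by w_j c_j^p and summed over j, the boundary terms tend to 0 with e,
again by the vanishing moments.  The second identity with q = 2s then passes
from the exponent a to a - 1, so the largest exponent a = 2m + sigma suffices.
For it, 2m + 1 uses of the first identity lead to
sum_j w_j c_j^(2m+1) J(c_j, sigma - 1, 2 sigma), where the odd power of c_j
groups the terms into differences J(c, ...) - J(-c, ...).

At these exponents the substitution u = x t / (x + c t) carries
(x + c t)^(sigma-1) t^(-2 sigma) dt into (x - c u)^(sigma-1) u^(-2 sigma) du.
Hence J(c, ...) at the cut-off e equals J(-c, ...) at x e / (x + c e), which is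
e - O(e^2), and the difference is an integral over an interval of length O(e^2)
of a function of size O(e^(-2 sigma)): it is O(e^(2 - 2 sigma)) and vanishes in
the limit ([power_tail_reflection_cvg]). *)

Set Implicit Arguments.
Unset Strict Implicit.
Unset Printing Implicit Defensive.

Import Order.TTheory GRing.Theory Num.Theory.
Import numFieldNormedType.Exports.

Local Open Scope classical_set_scope.
Local Open Scope ring_scope.

(** * Integrals over exhausted domains *)

Section exhaustion.
Context d (T : measurableType d) (R : realType).
Variable mu : {measure set T -> \bar R}.
Variables (D : set T) (A : nat -> set T) (f : T -> R).
Hypotheses (mD : measurable D) (mA : forall n, measurable (A n)).
Hypothesis AD : forall n, A n `<=` D.
Hypothesis DA : forall x, D x -> \forall n \near \oo, A n x.

Let restrict_cvg x : D x ->
  ((EFin \o f) \_ (A n) x) @[n --> \oo] --> (f x)%:E.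
Proof.
move=> Dx; apply: cvg_near_cst; near=> n.
by rewrite patchE mem_set//; near: n; exact: DA.
Unshelve. all: by end_near. Qed.

Let integral_restrict n : (\int[mu]_(x in A n) (f x)%:E =
  \int[mu]_(x in D) ((EFin \o f) \_ (A n)) x)%E.
Proof.
rewrite -[in LHS](setIidr (@AD n)) integral_mkcondr.
exact: eq_integral.
Qed.

Let measurable_patch n : measurable_fun D f ->
  measurable_fun D ((EFin \o f) \_ (A n) : T -> \bar R).
Proof.
move=> mf; apply: (iffLR (measurable_restrict _ (mA n) mD)).
rewrite setIidr//; apply/measurable_EFinP; exact: measurable_funS mf.
Qed.

(** Dominated convergence applied to the restrictions of [f] to the [A n]. *)
Lemma integrable_exhaust_cvg : mu.-integrable D (EFin \o f) ->
  (\int[mu]_(x in A n) (f x)%:E @[n --> \oo] --> \int[mu]_(x in D) (f x)%:E)%E.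
Proof.
move=> intf; under eq_fun do rewrite integral_restrict.
have /measurable_EFinP mf := measurable_int mu intf.
apply: (@dominated_cvg _ _ _ mu D mD (fun n => (EFin \o f) \_ (A n))
  (EFin \o f) (abse \o (EFin \o f))).
- by move=> n; exact: measurable_patch.
- exact: restrict_cvg.
- by [].
- exact: integrable_abse.
- move=> n x Dx /=; rewrite patchE; case: ifPn => _ //=.
  by rewrite ?normr0 lee_fin.
Qed.

(** Fatou's lemma for the restrictions of [f] to the [A n]. *)
Lemma ge0_exhaust_integrable (M : R) : measurable_fun D f ->
  (forall x, D x -> 0 <= f x) ->
  (forall n, \int[mu]_(x in A n) (f x)%:E <= M%:E)%E ->
  mu.-integrable D (EFin \o f).
Proof.
move=> mf f0 fM; apply/integrableP; split; first exact/measurable_EFinP.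
apply: (@le_lt_trans _ _ M%:E); last exact: ltry.
rewrite (eq_integral (fun x => limn_einf (fun n => (EFin \o f) \_ (A n) x))).
  have mfA n := @measurable_patch n mf.
  have fA0 n x : D x -> (0 <= ((EFin \o f) \_ (A n)) x)%E.
    by move=> Dx; rewrite patchE; case: ifPn => _//=; rewrite lee_fin f0.
  apply: (le_trans (fatou mu mD mfA fA0)).
  rewrite limn_einf_lim; apply: lime_le; first exact: is_cvg_einfs.
  apply: nearW => n; apply: (@le_trans _ _
    (\int[mu]_(x in D) ((EFin \o f) \_ (A n)) x)%E); last first.
    by rewrite -integral_restrict.
  by apply: ereal_inf_lbound; exists n => /=.
move=> x; rewrite inE => Dx.
rewrite is_cvg_limn_einfE; last by apply/cvg_ex; eexists; exact: restrict_cvg.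
by rewrite (cvg_lim _ (restrict_cvg Dx))//= ger0_norm// f0.
Qed.

End exhaustion.

Section improper_FTC.
Context {R : realType}.
Notation mu := (@lebesgue_measure R).
Variables (D : set R) (a b : nat -> R) (f F : R -> R) (l : R).
Hypothesis mD : measurable D.
Hypothesis ab : forall n, a n < b n.
Hypothesis abD : forall n, `[a n, b n] `<=` D.
Hypothesis Dab : forall x, D x -> \forall n \near \oo, a n <= x <= b n.
Hypothesis dF : forall x, D x -> is_derive x 1 F (f x).
Hypothesis cf : forall x, D x -> {for x, continuous f}.
Hypothesis Fl : F (b n) - F (a n) @[n --> \oo] --> l.

Let FTC n : (\int[mu]_(x in `[a n, b n]) (f x)%:E = (F (b n) - F (a n))%:E)%E.
Proof.
have cF x : D x -> {for x, continuous F}.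
  by move=> Dx; apply/differentiable_continuous/derivable1_diffP; case: (dF Dx).
have Da : D (a n) by apply: (@abD n); rewrite /= in_itv/= lexx ltW.
have Db : D (b n) by apply: (@abD n); rewrite /= in_itv/= lexx andbT ltW.
rewrite (@continuous_FTC2 _ f F) ?EFinB//.
- apply: continuous_in_subspaceT => x /[!inE] xab.
  by apply: cf; exact: abD xab.
- split.
  + move=> x xab; have Dx : D x by apply: (@abD n); exact: subset_itv_oo_cc.
    by case: (dF Dx).
  + exact/cvg_at_right_filter/cF.
  + exact/cvg_at_left_filter/cF.
- move=> x xab; have Dx : D x by apply: (@abD n); exact: subset_itv_oo_cc.
  by have [_ <-] := dF Dx; rewrite derive1E.
Qed.

(** The usual fundamental theorem on each [[a n, b n]], followed by a passage to
the limit.  Half-lines and integrable end-point singularities are both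
covered by the choice of [a] and [b]. *)
Lemma integrable_improper_FTC : mu.-integrable D (EFin \o f) ->
  (\int[mu]_(x in D) (f x)%:E = l%:E)%E.
Proof.
move=> intf.
have h : (\int[mu]_(x in `[a n, b n]) (f x)%:E @[n --> \oo] -->
    \int[mu]_(x in D) (f x)%:E)%E.
  by apply: integrable_exhaust_cvg => // x /Dab.
rewrite -(cvg_lim _ h)//; apply/cvg_lim => //.
under eq_fun do rewrite FTC.
by apply: cvg_EFin Fl; exact: nearW.
Qed.

(** A nonnegative derivative is integrable as soon as its primitive has limits at
the ends: this is how the integrability of powers is obtained below. *)
Lemma ge0_improper_FTC : measurable_fun D f -> (forall x, D x -> 0 <= f x) ->
  mu.-integrable D (EFin \o f).
Proof.
move=> mf f0; have [M [_ FM]] := cvg_seq_bounded (cvgP _ Fl).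
apply: (@ge0_exhaust_integrable _ _ _ mu D (fun n => `[a n, b n]%classic) f
  mD _ abD Dab (M + 1) mf f0) => // n.
rewrite FTC lee_fin (le_trans (ler_norm _))//.
by apply: FM => //; rewrite ltrDl.
Qed.

End improper_FTC.

(** * Real powers *)

Section real_powers.
Context {R : realType}.
Implicit Types (x c a q t e r : R).

Lemma gt0_powRD t a q : 0 < t -> t `^ (a + q) = t `^ a * t `^ q.
Proof.
by move=> t0; rewrite powRD//; apply/implyP => _; rewrite gt_eqF.
Qed.

Lemma le0_ler_powR a l y : a <= 0 -> 0 < l -> l <= y ->
  y `^ a <= l `^ a.
Proof.
move=> a0 l0 ly; have y0 := lt_le_trans l0 ly.
rewrite -(opprK a) !(powRN _ (- a)) lef_pV2 ?posrE ?powR_gt0//.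
by rewrite ge0_ler_powR ?nnegrE ?oppr_ge0// ltW.
Qed.

(** A bound for powers on a compact interval that holds for either sign of the
exponent. *)
Lemma powR_le_endpoints a l y u : 0 < l -> l <= y -> y <= u ->
  y `^ a <= l `^ a + u `^ a.
Proof.
move=> l0 ly yu; have y0 := lt_le_trans l0 ly; have u0 := lt_le_trans y0 yu.
have [a0|a0] := leP 0 a.
  by rewrite ler_wpDl ?powR_ge0// ge0_ler_powR ?nnegrE// ltW.
by rewrite ler_wpDr ?powR_ge0// le0_ler_powR// ltW.
Qed.

Lemma powR_seq_cvg0 (u : nat -> R) a : 0 < a -> (forall n, 0 < u n) ->
  u n @[n --> \oo] --> 0 -> u n `^ a @[n --> \oo] --> 0.
Proof. by move=> a0 u0 ucv; move/cvg_at_rightP : (powR_cvg0 a0); exact. Qed.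

Lemma invr_seq_cvg0 (k : nat) : (n + k.+1)%:R^-1 @[n --> \oo] --> (0 : R).
Proof.
under eq_fun do rewrite addnS -addSn.
have := @cvg_harmonic R.
by rewrite -(@cvg_shiftn k) => h; under eq_fun do rewrite addSn.
Qed.

Lemma is_derive_powR_affine x c a t : 0 < x + c * t ->
  is_derive t 1 (fun t => (x + c * t) `^ a) (a * c * (x + c * t) `^ (a - 1)).
Proof.
move=> xct.
have dl : is_derive t 1 (fun t => x + c * t) c.
  apply: is_derive_eq.
  by rewrite add0r mul1r /GRing.scale/= mulr1.
have := @is_derive1_comp R (fun y => y `^ a) (fun y => x + c * y) t _ _
  (is_derive1_powR a xct) dl.
by rewrite mulrAC.
Qed.

Lemma continuous_powR_affine x c a t : 0 < x + c * t ->
  {for t, continuous (fun t => (x + c * t) `^ a)}.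
Proof.
move=> xct; apply/differentiable_continuous/derivable1_diffP.
by case: (is_derive_powR_affine a xct).
Qed.

Lemma continuous_powRt a t : 0 < t -> {for t, continuous (fun t => t `^ a)}.
Proof.
move=> t0; apply/differentiable_continuous/derivable1_diffP.
by case: (is_derive1_powR a t0).
Qed.

Lemma measurable_pos_power a : measurable_fun [set: R] (fun t => pos_power t a).
Proof.
have mlt : measurable_fun [set: R] (fun t : R => 0 < t).
  exact: measurable_fun_ltr.
exact: (measurable_fun_ifT mlt (measurable_powR a) (@measurable_cst _ _ R R _ 0)).
Qed.

Lemma pos_power_ge0 t a : 0 <= pos_power t a.
Proof. by rewrite /pos_power; case: ifPn => // _; exact: powR_ge0. Qed.

Lemma pos_powerE t a : 0 < t -> pos_power t a = t `^ a.
Proof. by rewrite /pos_power => ->. Qed.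

Lemma pos_power0 t a : t <= 0 -> pos_power t a = 0.
Proof. by rewrite /pos_power leNgt => /negbTE ->. Qed.

Lemma pos_powerD1 t a : pos_power t a = t * pos_power t (a - 1).
Proof.
rewrite /pos_power; case: ifPn => [t0|]; last by rewrite mulr0.
by rewrite -{2}(powRr1 (ltW t0)) -gt0_powRD// addrC subrK.
Qed.

End real_powers.

Section integrable_powers.
Context {R : realType}.
Notation mu := (@lebesgue_measure R).
Implicit Types (x c a q t e r : R).

Lemma integrable_powR_ygt1 e r : 0 < e -> 1 < r ->
  mu.-integrable `[e, +oo[ (EFin \o (fun t => t `^ (- r))).
Proof.
move=> e0 r1.
apply: (@ge0_improper_FTC _ _ (fun=> e) (fun n => e + n.+1%:R) _
  (fun t => (1 - r)^-1 * t `^ (1 - r)) (- ((1 - r)^-1 * e `^ (1 - r)))) => //.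
- by move=> n; rewrite ltrDl.
- by move=> n x /=; rewrite !in_itv/= => /andP[-> _].
- move=> x /=; rewrite in_itv/= andbT => ex; near=> n.
  rewrite ex/= (@le_trans _ _ n.+1%:R)//; last by rewrite lerDr ltW.
  rewrite (@le_trans _ _ n%:R) ?ler_nat//.
  by near: n; exact: nbhs_infty_ger.
- move=> x /=; rewrite in_itv/= andbT => ex; have x0 := lt_le_trans e0 ex.
  have := is_deriveZ (1 - r)^-1 (is_derive1_powR (1 - r) x0).
  rewrite /= [X in is_derive _ _ _ X](_ : _ = x `^ (- r))//.
  rewrite /GRing.scale/= mulrA mulVf ?mul1r; last by lra.
  by congr (_ `^ _); ring.
- move=> x /=; rewrite in_itv/= andbT => ex; have x0 := lt_le_trans e0 ex.
  exact: continuous_powRt.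
- rewrite -[X in _ --> X]add0r; apply: cvgB; last exact: cvg_cst.
  rewrite -(mulr0 (1 - r)^-1); apply: cvgM; first exact: cvg_cst.
  have -> : (fun n => (e + n.+1%:R) `^ (1 - r)) =
            (fun n => ((e + n.+1%:R)^-1) `^ (r - 1)).
    apply/funext => n; rewrite -powR_inv1; last by rewrite addr_ge0// ltW.
    by rewrite -powRrM; congr (_ `^ _); ring.
  apply: powR_seq_cvg0; first by lra.
    by move=> n; rewrite invr_gt0 ltr_wpDr.
  apply: (@squeeze_cvgr _ _ _ _ (fun=> 0) (fun n => n.+1%:R^-1)).
  + apply: nearW => n; rewrite invr_ge0 addr_ge0//= ?(ltW e0)//.
    by rewrite lef_pV2 ?posrE// ?ltr_wpDr// lerDr ltW.
  + exact: cvg_cst.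
  + exact: cvg_harmonic.
- by apply: measurable_funTS; exact: measurable_powR.
- by move=> x _; exact: powR_ge0.
Unshelve. all: by end_near. Qed.

Lemma integrable_powR_0 r e : 0 < e -> -1 < r ->
  mu.-integrable `]0, e] (EFin \o (fun t => t `^ r)).
Proof.
move=> e0 r1.
apply: (@ge0_improper_FTC _ _ (fun n => e * (n + 2)%:R^-1) (fun=> e) _
  (fun t => (r + 1)^-1 * t `^ (r + 1)) ((r + 1)^-1 * e `^ (r + 1))) => //.
- by move=> n; rewrite gtr_pMr// invf_lt1// ltr1n addn2.
- move=> n x /=; rewrite !in_itv/= => /andP[ex ->]; rewrite andbT.
  by rewrite (lt_le_trans _ ex)// mulr_gt0// invr_gt0 ltr0n addn2.
- move=> x /=; rewrite in_itv/= => /andP[x0 xe]; near=> n.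
  rewrite xe andbT; apply: ltW; near: n.
  have h : e * (n + 2)%:R^-1 @[n --> \oo] --> 0.
    rewrite -(mulr0 e); apply: cvgM; first exact: cvg_cst.
    exact: invr_seq_cvg0.
  by move/cvgrPdist_lt : h => /(_ x x0); apply: filterS => n /=;
    rewrite sub0r normrN => /(le_lt_trans (ler_norm _)).
- move=> x /=; rewrite in_itv/= => /andP[x0 _].
  have := is_deriveZ (r + 1)^-1 (is_derive1_powR (r + 1) x0).
  rewrite /= [X in is_derive _ _ _ X](_ : _ = x `^ r)//.
  rewrite /GRing.scale/= mulrA mulVf ?mul1r; last by lra.
  by congr (_ `^ _); ring.
- move=> x /=; rewrite in_itv/= => /andP[x0 _].
  exact: continuous_powRt.
- rewrite -[X in _ --> X]subr0; apply: cvgB; first exact: cvg_cst.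
  rewrite -(mulr0 (r + 1)^-1); apply: cvgM; first exact: cvg_cst.
  apply: powR_seq_cvg0; first by lra.
    by move=> n; rewrite mulr_gt0// invr_gt0 ltr0n addn2.
  rewrite -(mulr0 e); apply: cvgM; first exact: cvg_cst.
  exact: invr_seq_cvg0.
- by apply: measurable_funTS; exact: measurable_powR.
- by move=> x _; exact: powR_ge0.
Unshelve. all: by end_near. Qed.

End integrable_powers.

(** * Tails of truncated powers *)

Section support.
Context d (T : measurableType d) (R : realType).
Variable mu : {measure set T -> \bar R}.
Variables (D E : set T) (f : T -> R).
Hypotheses (mD : measurable D) (mE : measurable E) (ED : E `<=` D).
Hypothesis f0 : forall x, D x -> ~ E x -> f x = 0.

Let patch_support : {in D, (EFin \o f) \_ E =1 EFin \o f}.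
Proof.
move=> x; rewrite inE => Dx; rewrite patchE.
by case: ifPn => //; rewrite notin_setE => Ex /=; rewrite f0.
Qed.

Lemma integrable_support : mu.-integrable E (EFin \o f) ->
  mu.-integrable D (EFin \o f).
Proof.
move=> intf; apply: eq_integrable patch_support _; first exact: mD.
by apply: (iffLR (integrable_restrict mu mE mD _)); rewrite setIidr.
Qed.

Lemma integral_support :
  (\int[mu]_(x in D) (f x)%:E = \int[mu]_(x in E) (f x)%:E)%E.
Proof.
rewrite -[in RHS](setIidr ED) integral_mkcondr; apply/esym.
exact: eq_integral patch_support.
Qed.

End support.

Section power_kernel.
Context {R : realType}.
Notation mu := (@lebesgue_measure R).
Implicit Types (x c a q t e r : R).

Definition power_kernel x c a q t : R := pos_power (x + c * t) a * t `^ (- q).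

Definition power_tail x c a q e : R :=
  \int[mu]_(t in `[e, +oo[) power_kernel x c a q t.

Definition positivity_domain x c e : set R :=
  `[e, +oo[ `&` [set t | 0 < x + c * t].

(** Right end points of intervals [[e, b n]] filling [positivity_domain x c e].  For
[c < 0] this domain ends at [- x / c], where a power of [x + c * t] may blow
up, and [b n] is such that [x + c * b n = (x + c * e) / (n + 2)]. *)
Definition positivity_exhaustion x c e n : R :=
  if c < 0 then e + (x + c * e) * (1 - (n + 2)%:R^-1) / (- c)
  else e + n.+1%:R.

Lemma measurable_affine x c : measurable_fun [set: R] (fun t => x + c * t).
Proof. by apply: measurable_funD => //; exact: measurable_funM. Qed.

Lemma measurable_power_kernel x c a q :
  measurable_fun [set: R] (power_kernel x c a q).
Proof.
apply: measurable_funM; last exact: measurable_powR.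
exact: (measurableT_comp (measurable_pos_power a) (measurable_affine x c)).
Qed.

Lemma power_kernel_ge0 x c a q t : 0 <= power_kernel x c a q t.
Proof. by rewrite mulr_ge0 ?pos_power_ge0// powR_ge0. Qed.

Lemma measurable_positivity_domain x c e :
  measurable (positivity_domain x c e).
Proof.
apply: measurableI => //.
have mlt : measurable_fun [set: R] (fun t => 0 < x + c * t).
  by apply: measurable_fun_ltr => //; exact: measurable_affine.
have := mlt measurableT [set true] I.
by rewrite setTI; congr measurable; apply/seteqP; split => t.
Qed.

Lemma power_kernel_out x c a q e t : `[e, +oo[%classic t ->
  ~ positivity_domain x c e t -> power_kernel x c a q t = 0.
Proof.
move=> et nt; rewrite /power_kernel pos_power0 ?mul0r// leNgt.
by apply/negP => xct; apply: nt.
Qed.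

Section exhaustion.
Variables (x c e : R).
Hypotheses (x0 : 0 < x) (e0 : 0 < e) (xce : 0 < x + c * e).
Let b := positivity_exhaustion x c e.

Lemma positivity_exhaustionE n : c < 0 -> x + c * b n = (x + c * e) / (n + 2)%:R.
Proof.
move=> c0; rewrite /b /positivity_exhaustion c0 invrN.
have cn0 : c != 0 by rewrite lt_eqF.
have n0 : (n + 2)%:R != 0 :> R by rewrite pnatr_eq0 addn2.
by move: (n + 2)%:R n0 => N N0; field; rewrite ?cn0 ?N0.
Qed.

Lemma lt_positivity_exhaustion n : e < b n.
Proof.
rewrite /b /positivity_exhaustion; case: ifPn => [c0|_]; rewrite ltrDl//.
rewrite divr_gt0 ?oppr_gt0// mulr_gt0// subr_gt0 invf_lt1 ?ltr1n ?addn2//.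
Qed.

Lemma positivity_exhaustion_sub n : `[e, b n] `<=` positivity_domain x c e.
Proof.
move=> t /=; rewrite in_itv/= => /andP[et tb].
split => /=; first by rewrite in_itv/= et.
have [c0|c0] := ltP c 0; last first.
  by rewrite ltr_wpDr// mulr_ge0// (le_trans _ et)// ltW.
apply: (@lt_le_trans _ _ (x + c * b n)); last by rewrite lerD2l ler_nM2l.
by rewrite positivity_exhaustionE// divr_gt0// ltr0n addn2.
Qed.

Lemma positivity_exhaustion_cover t : positivity_domain x c e t ->
  \forall n \near \oo, e <= t <= b n.
Proof.
move=> [/=]; rewrite in_itv/= andbT => et xct; near=> n.
rewrite et/=; have [c0|c0] := ltP c 0; last first.
  rewrite /b /positivity_exhaustion ltNge c0/=.
  rewrite (@le_trans _ _ n.+1%:R)//; last by rewrite lerDr ltW.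
  rewrite (@le_trans _ _ n%:R) ?ler_nat//.
  by near: n; exact: nbhs_infty_ger.
rewrite -(ler_nM2l c0) -(lerD2l x) positivity_exhaustionE//; apply: ltW; near: n.
have h : (x + c * e) / (n + 2)%:R @[n --> \oo] --> 0.
  rewrite -(mulr0 (x + c * e)); apply: cvgM; first exact: cvg_cst.
  exact: invr_seq_cvg0.
by move/cvgrPdist_lt : h => /(_ _ xct); apply: filterS => n /=;
  rewrite sub0r normrN => /(le_lt_trans (ler_norm _)).
Unshelve. all: by end_near. Qed.

(** For [t >= e], [x + c * t] is at most [x / e + c] times [t]. *)
Lemma le_power_tail_kernel a q t : 0 <= c -> 0 <= a -> e <= t ->
  (x + c * t) `^ a * t `^ (- q) <= (x / e + c) `^ a * t `^ (- (q - a)).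
Proof.
move=> c0 a0 et; have t0 := lt_le_trans e0 et.
rewrite opprB gt0_powRD// mulrA ler_wpM2r ?powR_ge0//.
rewrite -powRM ?addr_ge0 ?divr_ge0 ?(ltW x0) ?(ltW e0) ?(ltW t0)//.
rewrite ge0_ler_powR ?nnegrE ?addr_ge0 ?mulr_ge0 ?addr_ge0 ?divr_ge0//;
  rewrite ?(ltW x0) ?(ltW e0) ?(ltW t0)//.
by rewrite mulrDl lerD2r mulrAC ler_pdivlMr// ler_wpM2l// ltW.
Qed.

(** The primitive [(x + c * t) ^ a * t ^ (- q)] vanishes at the right end of the
positivity domain, be it finite (since [0 < a]) or infinite (since [a < q]). *)
Lemma positivity_exhaustion_cvg a q : 0 < a -> a < q ->
  (x + c * b n) `^ a * b n `^ (- q) @[n --> \oo] --> 0.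
Proof.
move=> a0 aq; have b0 n : 0 < b n := lt_trans e0 (lt_positivity_exhaustion n).
have [c0|c0] := ltP c 0.
- apply: (@squeeze_cvgr _ _ _ _ (fun=> 0)
    (fun n => ((x + c * e) / (n + 2)%:R) `^ a * e `^ (- q))).
  + apply: nearW => n; rewrite mulr_ge0 ?powR_ge0//=.
    rewrite positivity_exhaustionE// ler_wpM2l ?powR_ge0//.
    rewrite !powRN lef_pV2 ?posrE ?powR_gt0// ge0_ler_powR ?nnegrE ?(ltW (b0 _)) ?(ltW e0)//.
      by rewrite ltW// (lt_trans a0).
    exact/ltW/lt_positivity_exhaustion.
  + exact: cvg_cst.
  + rewrite -[X in _ --> X](mul0r (e `^ (- q))); apply: cvgM; last exact: cvg_cst.
    apply: powR_seq_cvg0 => //.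
      by move=> n; rewrite divr_gt0// ltr0n addn2.
    rewrite -(mulr0 (x + c * e)); apply: cvgM; first exact: cvg_cst.
    exact: invr_seq_cvg0.
- apply: (@squeeze_cvgr _ _ _ _ (fun=> 0)
    (fun n => (x / e + c) `^ a * ((b n)^-1) `^ (q - a))).
  + apply: nearW => n; rewrite mulr_ge0 ?powR_ge0//=.
    rewrite -(powR_inv1 (ltW (b0 n))) -powRrM mulN1r.
    by apply: le_power_tail_kernel; rewrite ?(ltW a0)// ltW// lt_positivity_exhaustion.
  + exact: cvg_cst.
  + rewrite -[X in _ --> X](mulr0 ((x / e + c) `^ a)); apply: cvgM; first exact: cvg_cst.
    apply: powR_seq_cvg0; first by rewrite subr_gt0.
      by move=> n; rewrite invr_gt0.
    apply: (@squeeze_cvgr _ _ _ _ (fun=> 0) (fun n => n.+1%:R^-1)).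
    * apply: nearW => n; rewrite invr_ge0 (ltW (b0 n))//=.
      rewrite lef_pV2 ?posrE// /b /positivity_exhaustion ltNge c0/=.
      by rewrite lerDr ltW.
    * exact: cvg_cst.
    * exact: cvg_harmonic.
Qed.

End exhaustion.

End power_kernel.

Lemma integrable_scale d (T : measurableType d) (R : realType)
    (mu : {measure set T -> \bar R}) (D : set T) (k : R) (f : T -> R) :
  measurable D -> mu.-integrable D (EFin \o f) ->
  mu.-integrable D (EFin \o (fun t => k * f t)).
Proof.
move=> mD fi; have := integrableZl mD k fi.
by apply: eq_integrable => // t _ /=; rewrite EFinM.
Qed.

Section power_tail.
Context {R : realType}.
Notation mu := (@lebesgue_measure R).
Variables (x c e : R).
Hypotheses (x0 : 0 < x) (e0 : 0 < e) (xce : 0 < x + c * e).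
Implicit Types (a q t : R).

Let positivity_gt0 t : positivity_domain x c e t -> 0 < t /\ 0 < x + c * t.
Proof. by move=> [/=]; rewrite in_itv/= andbT => /(lt_le_trans e0). Qed.

Let positivity_kernelE a q t : positivity_domain x c e t ->
  power_kernel x c a q t = (x + c * t) `^ a * t `^ (- q).
Proof. by move=> /positivity_gt0[_ xct]; rewrite /power_kernel pos_powerE. Qed.

Let integrable_powR_affine a : c < 0 -> -1 < a ->
  mu.-integrable (positivity_domain x c e) (EFin \o (fun t => (x + c * t) `^ a)).
Proof.
move=> c0 a1.
apply: (@ge0_improper_FTC _ _ (fun=> e) (positivity_exhaustion x c e) _
  (fun t => (c * (a + 1))^-1 * (x + c * t) `^ (a + 1))
  (- ((c * (a + 1))^-1 * (x + c * e) `^ (a + 1)))).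
- exact: measurable_positivity_domain.
- exact: lt_positivity_exhaustion.
- exact: positivity_exhaustion_sub.
- exact: positivity_exhaustion_cover.
- move=> t /positivity_gt0[_ xct].
  have := is_deriveZ (c * (a + 1))^-1 (is_derive_powR_affine (a + 1) xct).
  rewrite /= [X in is_derive _ _ _ X](_ : _ = (x + c * t) `^ a)//.
  rewrite /GRing.scale/= addrK mulrA [_ * c]mulrC mulVf ?mul1r//.
  by apply: mulf_neq0; [rewrite lt_eqF|rewrite gt_eqF//; lra].
- by move=> t /positivity_gt0[_ xct]; exact: continuous_powR_affine.
- rewrite -[X in _ --> X]add0r; apply: cvgB; last exact: cvg_cst.
  rewrite -[X in _ --> X](mulr0 (c * (a + 1))^-1); apply: cvgM; first exact: cvg_cst.
  under eq_fun do rewrite positivity_exhaustionE//.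
  apply: powR_seq_cvg0; first by lra.
    by move=> n; rewrite divr_gt0// ltr0n addn2.
  rewrite -(mulr0 (x + c * e)); apply: cvgM; first exact: cvg_cst.
  exact: invr_seq_cvg0.
- apply: measurable_funTS.
  exact: (measurableT_comp (measurable_powR a) (measurable_affine x c)).
- by move=> t _; exact: powR_ge0.
Qed.

(** The kernel behaves like [t ^ (a - q)] at infinity if [c > 0], like
[t ^ (- q)] if [c = 0], and has a zero or an integrable singularity at
[- x / c] if [c < 0]. *)
Lemma integrable_power_kernel a q : -1 < a -> 1 + a < q -> (c = 0 -> 1 < q) ->
  mu.-integrable `[e, +oo[ (EFin \o power_kernel x c a q).
Proof.
move=> a1 aq cq.
have mk D : measurable_fun D (EFin \o power_kernel x c a q).
  by apply/measurable_EFinP/measurable_funTS; exact: measurable_power_kernel.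
have mt D r : measurable_fun D (EFin \o (fun t : R => t `^ r)).
  by apply/measurable_EFinP/measurable_funTS; exact: measurable_powR.
have [c0|c0|c0] := ltgtP c 0.
- apply: (@integrable_support _ _ _ mu _ _ (power_kernel x c a q) _
    (measurable_positivity_domain x c e)) => //.
  + exact: subIsetl.
  + by move=> t et; exact: power_kernel_out.
  apply: (@le_integrable _ _ _ mu _ (measurable_positivity_domain x c e) _
    (fun t => (e `^ (- q))%:E * ((x + c * t) `^ a)%:E)%E).
  + exact: mk.
  + move=> t Dt; rewrite /= lee_fin ger0_norm ?power_kernel_ge0//.
    rewrite ger0_norm ?mulr_ge0 ?powR_ge0//.
    have [t0 xct] := positivity_gt0 Dt.
    rewrite positivity_kernelE// mulrC ler_wpM2r ?powR_ge0//.
    rewrite !powRN lef_pV2 ?posrE ?powR_gt0// ge0_ler_powR ?nnegrE ?(ltW t0) ?(ltW e0)//.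
      by lra.
    by case: Dt; rewrite /= in_itv/= andbT.
  + apply: integrableZl; first exact: measurable_positivity_domain.
    exact: integrable_powR_affine.
- apply: (@le_integrable _ _ _ mu _ _ _
    (fun t => (c `^ a + (x / e + c) `^ a)%:E * (t `^ (- (q - a)))%:E)%E) => //.
  + exact: mk.
  + move=> t; rewrite /= in_itv/= andbT => et; have t0 := lt_le_trans e0 et.
    rewrite lee_fin ger0_norm ?power_kernel_ge0//.
    rewrite ger0_norm ?mulr_ge0 ?addr_ge0 ?powR_ge0//.
    have xct : 0 < x + c * t by rewrite addr_gt0// mulr_gt0.
    rewrite /power_kernel pos_powerE// opprB gt0_powRD// mulrA ler_wpM2r ?powR_ge0//.
    (* Factoring out t leaves a quantity between c and x / e + c. *)
    have -> : x + c * t = (x / t + c) * t by field; rewrite gt_eqF.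
    rewrite powRM ?addr_ge0 ?divr_ge0 ?(ltW x0) ?(ltW t0) ?(ltW c0)//.
    rewrite ler_wpM2r ?powR_ge0// powR_le_endpoints ?lerDr ?divr_ge0 ?(ltW x0) ?(ltW t0)//.
    by rewrite lerD2r ler_wpM2l ?(ltW x0)// lef_pV2.
  + by apply: integrableZl => //; apply: integrable_powR_ygt1 => //; lra.
- apply: (@eq_integrable _ _ _ mu _ _ (fun t => (x `^ a)%:E * (t `^ (- q))%:E)%E) => //.
    by move=> t _; rewrite /= /power_kernel c0 mul0r addr0 pos_powerE.
  by apply: integrableZl => //; apply: integrable_powR_ygt1 => //; exact: cq.
Qed.

Let integrable_scaled_kernel a q : 0 < a -> a < q ->
  mu.-integrable `[e, +oo[ (EFin \o (fun t => c * power_kernel x c (a - 1) q t)).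
Proof.
move=> a0 aq; have [c0|c0] := eqVneq c 0.
  apply: (@eq_integrable _ _ _ mu _ _ (cst 0%E)) => //; last exact: integrable0.
  by move=> t _ /=; rewrite c0 mul0r.
apply: integrable_scale => //; apply: integrable_power_kernel; [lra|lra|].
by move=> /eqP; rewrite (negbTE c0).
Qed.

(** For [c = 0] the tail on the right may be an infinite integral, which the real
valued integral sends to 0; the factor [c] makes the equation true anyway. *)
Let scaled_tailE a q : 0 < a -> a < q ->
  \int[mu]_(t in `[e, +oo[) (c * power_kernel x c (a - 1) q t) =
  c * power_tail x c (a - 1) q e.
Proof.
move=> a0 aq; have [c0|c0] := eqVneq c 0.
  rewrite (@eq_Rintegral _ _ _ _ _ (fun=> 0)) => [|t _]; last by rewrite c0 mul0r.
  by rewrite c0 mul0r /Rintegral integral0.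
rewrite RintegralZl//; apply: integrable_power_kernel; [lra|lra|].
by move=> /eqP; rewrite (negbTE c0).
Qed.

Let kernel_split a q t : `[e, +oo[%classic t -> 0 < a -> a < q ->
  power_kernel x c a (q + 1) t =
  c * power_kernel x c (a - 1) q t + x * power_kernel x c (a - 1) (q + 1) t.
Proof.
rewrite /= in_itv/= andbT => et a0 aq; have t0 := lt_le_trans e0 et.
rewrite /power_kernel pos_powerD1.
have -> : t `^ (- q) = t * t `^ (- (q + 1)).
  by rewrite -{2}(powRr1 (ltW t0)) -gt0_powRD//; congr (_ `^ _); ring.
by ring.
Qed.

(** Integrates [(x + c t)^a = c t (x + c t)^(a-1) + x (x + c t)^(a-1)]. *)
Lemma power_tail_split a q : 0 < a -> a < q ->
  power_tail x c a (q + 1) e =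
  c * power_tail x c (a - 1) q e + x * power_tail x c (a - 1) (q + 1) e.
Proof.
move=> a0 aq.
have i1 := integrable_scaled_kernel a0 aq.
have i2 : mu.-integrable `[e, +oo[ (EFin \o power_kernel x c (a - 1) (q + 1)).
  by apply: integrable_power_kernel; lra.
rewrite -(scaled_tailE a0 aq) -RintegralZl// -RintegralD//; last first.
  exact: integrable_scale.
by apply: eq_Rintegral => t; rewrite inE => et; exact: kernel_split.
Qed.

(** Integration by parts: the derivative of [(x + c t)^a t^(-q)] has integral
[- (x + c e)^a e^(-q)]. *)
Lemma power_tail_parts a q : 0 < a -> a < q ->
  q * power_tail x c a (q + 1) e =
  a * (c * power_tail x c (a - 1) q e) + (x + c * e) `^ a * e `^ (- q).
Proof.
move=> a0 aq.
pose f t := a * (c * power_kernel x c (a - 1) q t) - q * power_kernel x c a (q + 1) t.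
have i1 : mu.-integrable `[e, +oo[
    (EFin \o (fun t => a * (c * power_kernel x c (a - 1) q t))).
  by apply: integrable_scale => //; exact: integrable_scaled_kernel.
have i2' : mu.-integrable `[e, +oo[ (EFin \o power_kernel x c a (q + 1)).
  by apply: integrable_power_kernel; lra.
have i2 : mu.-integrable `[e, +oo[
    (EFin \o (fun t => q * power_kernel x c a (q + 1) t)).
  exact: integrable_scale.
suff : \int[mu]_(t in `[e, +oo[) f t = - ((x + c * e) `^ a * e `^ (- q)).
  rewrite RintegralB// RintegralZl//; last exact: integrable_scaled_kernel.
  rewrite scaled_tailE// RintegralZl// /power_tail => h; lra.
have mD := measurable_positivity_domain x c e.
have D_sub : positivity_domain x c e `<=` `[e, +oo[ by exact: subIsetl.
rewrite /Rintegral (integral_support mu D_sub)//; last first.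
  by move=> t et nt; rewrite /f !(power_kernel_out _ _ et nt) !mulr0 subr0.
pose g t := a * c * (x + c * t) `^ (a - 1) * t `^ (- q) -
  q * (x + c * t) `^ a * t `^ (- q - 1).
have fg : {in positivity_domain x c e, f =1 g}.
  move=> t; rewrite inE => Dt; rewrite /f /g !positivity_kernelE// opprD.
  by ring.
rewrite (@eq_integral _ _ _ mu _ (EFin \o g)) => [|t Dt]; last by rewrite /= fg.
suff /= -> : (\int[mu]_(t in positivity_domain x c e) (g t)%:E =
    (- ((x + c * e) `^ a * e `^ (- q)))%:E)%E by [].
apply: (@integrable_improper_FTC _ _ (fun=> e) (positivity_exhaustion x c e) g
  (fun t => (x + c * t) `^ a * t `^ (- q))) => //.
- exact: lt_positivity_exhaustion.
- exact: positivity_exhaustion_sub.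
- exact: positivity_exhaustion_cover.
- move=> t /positivity_gt0[t0 xct].
  have := is_deriveM (is_derive_powR_affine a xct) (is_derive1_powR (- q) t0).
  rewrite [X in is_derive _ _ _ X -> _](_ : _ = g t)//.
  by rewrite /g /GRing.scale/=; ring.
- move=> t /positivity_gt0[t0 xct]; apply: cvgB; apply: cvgM.
  + apply: cvgM; [exact: cvg_cst|exact: continuous_powR_affine].
  + exact: continuous_powRt.
  + apply: cvgM; [exact: cvg_cst|exact: continuous_powR_affine].
  + exact: continuous_powRt.
- rewrite -[X in _ --> X]add0r; apply: cvgB; last exact: cvg_cst.
  exact: positivity_exhaustion_cvg.
- apply: (@eq_integrable _ _ _ mu _ mD (EFin \o f)).
    by move=> t Dt; rewrite /= fg.
  apply: (@integrableS _ _ _ mu `[e, +oo[) => //.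
  have := integrableB _ i1 i2; rewrite /= => /(_ (measurable_itv _)).
  exact: eq_integrable.
Qed.

(** Eliminates [c * power_tail x c (a - 1) q e] between [power_tail_parts] and
[power_tail_split]. *)
Lemma power_tail_recurrence a q : 0 < a -> a < q ->
  (q - a) * power_tail x c a (q + 1) e +
    a * x * power_tail x c (a - 1) (q + 1) e =
  (x + c * e) `^ a * e `^ (- q).
Proof.
move=> a0 aq.
have -> : (x + c * e) `^ a * e `^ (- q) =
    q * power_tail x c a (q + 1) e - a * (c * power_tail x c (a - 1) q e).
  by rewrite power_tail_parts//; ring.
by rewrite power_tail_split//; ring.
Qed.

End power_tail.

(** * Comparing opposite nodes *)

Section mobius.
Context {R : realType}.
Notation mu := (@lebesgue_measure R).
Variables (x c s : R).
Hypotheses (x0 : 0 < x) (c0 : 0 < c) (s0 : 0 < s) (s1 : s < 1).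
Implicit Types (t e T : R).

Definition mobius t : R := x * t / (x + c * t).

Let exponent_gtN1 : -1 < s - 1. Proof. by move: s0 => ?; lra. Qed.

Let exponent_lt : 1 + (s - 1) < 2 * s. Proof. by move: s0 => ?; lra. Qed.

Let den_gt0 t : 0 < t -> 0 < x + c * t.
Proof. by move=> t0; rewrite addr_gt0// mulr_gt0. Qed.

Lemma mobius_gt0 t : 0 < t -> 0 < mobius t.
Proof. by move=> t0; rewrite divr_gt0 ?mulr_gt0 ?den_gt0. Qed.

Lemma mobius_lt t : 0 < t -> 0 < x - c * mobius t.
Proof.
move=> t0; have d0 := den_gt0 t0.
have -> : x - c * mobius t = x ^+ 2 / (x + c * t).
  by rewrite /mobius; field; rewrite gt_eqF.
by rewrite divr_gt0// exprn_gt0.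
Qed.

Lemma mobius_le t : 0 < t -> mobius t <= t.
Proof.
move=> t0; have d0 := den_gt0 t0.
by rewrite ler_pdivrMr// mulrC ler_wpM2l ?(ltW t0)// lerDl mulr_ge0 ?ltW.
Qed.

Let mobius_homo t T : 0 < t -> t < T -> mobius t < mobius T.
Proof.
move=> t0 tT; have d0 := den_gt0 t0; have D0 := den_gt0 (lt_trans t0 tT).
rewrite ltr_pdivrMr// mulrAC ltr_pdivlMr//.
rewrite -subr_gt0 (_ : _ - _ = x ^+ 2 * (T - t)); last by ring.
by rewrite mulr_gt0 ?exprn_gt0// subr_gt0.
Qed.

Let is_derive_mobius t : 0 < t ->
  is_derive t 1 mobius (x ^+ 2 * (x + c * t) ^- 2).
Proof.
move=> t0; have d0 := den_gt0 t0.
have dl : is_derive t 1 (fun t => x + c * t) c.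
  apply: is_derive_eq.
  by rewrite add0r mul1r /GRing.scale/= mulr1.
have dx : is_derive t 1 (fun t => x * t) x.
  by apply: is_derive_eq; rewrite /GRing.scale/= mulr1.
have dn : x + c * t != 0 by rewrite gt_eqF.
have := is_deriveM dx (is_deriveV (f := fun t => x + c * t) dn dl).
rewrite [X in is_derive _ _ _ X -> _](_ : _ = x ^+ 2 * (x + c * t) ^- 2)//.
by rewrite /GRing.scale/=; field.
Qed.

Let mobius_derive1 t : 0 < t -> mobius^`()%classic t = x ^+ 2 * (x + c * t) ^- 2.
Proof. by move=> t0; have [_ <-] := is_derive_mobius t0; rewrite derive1E. Qed.

Let continuous_mobius t : 0 < t -> {for t, continuous mobius}.
Proof.
move=> t0; apply/differentiable_continuous/derivable1_diffP.
by case: (is_derive_mobius t0).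
Qed.

Let continuous_dmobius t : 0 < t -> {for t, continuous mobius^`()%classic}.
Proof.
move=> t0; have d0 := den_gt0 t0.
rewrite /prop_for /continuous_at mobius_derive1//.
apply: (@cvg_trans _ ((x ^+ 2 * (x + c * u) ^- 2) @[u --> t])).
  apply: near_eq_cvg; near=> u; rewrite mobius_derive1//.
  by near: u; exact: lt_nbhsr.
have cl : {for t, continuous (fun u => x + c * u)}.
  apply: cvgD; first exact: cvg_cst.
  by apply: cvgM; [exact: cvg_cst|exact: cvg_id].
have cV : {for t, continuous (fun u => ((x + c * u) ^+ 2)^-1)}.
  apply: (@continuousV _ _ (fun u => (x + c * u) ^+ 2)).
    by rewrite gt_eqF// exprn_gt0.
  exact: (continuousM cl cl).
exact: (continuousM (cvg_cst (x ^+ 2)) cV).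
Unshelve. all: by end_near. Qed.

(** The exponents [s - 1] and [2 * s] are exactly those for which the powers of
[x + c t] produced by the substitution, including the two of the Jacobian, add
up to [s - 1]. *)
Let mobius_kernel t : 0 < t ->
  power_kernel x (- c) (s - 1) (2 * s) (mobius t) * mobius^`()%classic t =
  power_kernel x c (s - 1) (2 * s) t.
Proof.
move=> t0; have d0 := den_gt0 t0.
rewrite /power_kernel mobius_derive1// !pos_powerE//; last first.
  by rewrite mulNr mobius_lt.
have -> : x + - c * mobius t = x ^+ 2 / (x + c * t).
  by rewrite /mobius; field; rewrite gt_eqF.
rewrite /mobius -powR_inv1 ?(ltW d0)// -!powR_mulrn ?(ltW x0) ?(ltW d0)//.
rewrite -[(_ `^ 2)^-1]powRN.
rewrite !powRM ?mulr_ge0 ?powR_ge0 ?(ltW x0) ?(ltW t0)//.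
rewrite -!powRrM.
rewrite [LHS](_ : _ = x `^ (2 * (s - 1)) * x `^ (- (2 * s)) * x `^ 2 *
  (((x + c * t) `^ (-1 * (s - 1)) * (x + c * t) `^ (-1 * (- (2 * s)))) *
   (x + c * t) `^ (- 2)) * t `^ (- (2 * s))); last by ring.
rewrite -!gt0_powRD//.
rewrite (_ : _ + _ + 2 = 0) ?powRr0 ?mul1r; last by ring.
by congr (_ `^ _ * _); ring.
Qed.

Let subst_mobius e T : 0 < e -> e < T ->
  (\int[mu]_(t in `[mobius e, mobius T])
     (power_kernel x (- c) (s - 1) (2 * s) t)%:E =
  \int[mu]_(t in `[e, T]) (power_kernel x c (s - 1) (2 * s) t)%:E)%E.
Proof.
move=> e0 eT; have T0 := lt_trans e0 eT.
(* The untruncated kernel, which is continuous on the interval below x / c. *)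
pose G u := (x + - c * u) `^ (s - 1) * u `^ (- (2 * s)).
have GE u : u \in `[mobius e, mobius T] ->
    power_kernel x (- c) (s - 1) (2 * s) u = G u.
  rewrite in_itv/= => /andP[_ uT]; rewrite /power_kernel pos_powerE//.
  rewrite (lt_le_trans (mobius_lt T0))// mulNr lerD2l lerN2.
  by rewrite ler_wpM2l// ltW.
transitivity (\int[mu]_(t in `[mobius e, mobius T]) (G t)%:E)%E.
  by apply: eq_integral => u; rewrite inE/= => ue; rewrite GE.
rewrite (@integration_by_substitution_increasing _ mobius G e T).
- apply: eq_integral => t; rewrite inE/= in_itv/= => /andP[et tT].
  have t0 := lt_le_trans e0 et.
  rewrite -mobius_kernel// GE// in_itv/=.
  apply/andP; split.
    by move: et; rewrite le_eqVlt => /predU1P[<-//|/(mobius_homo e0)/ltW].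
  by move: tT; rewrite le_eqVlt => /predU1P[->//|/(mobius_homo t0)/ltW].
- exact: ltW.
- move=> u v; rewrite !in_itv/= => /andP[eu _] _ uv.
  exact/mobius_homo/uv/(lt_le_trans e0).
- move=> u; rewrite in_itv/= => /andP[eu _].
  exact/continuous_dmobius/(lt_trans e0).
- apply/cvg_ex; exists (mobius^`()%classic e).
  exact/cvg_at_right_filter/continuous_dmobius.
- apply/cvg_ex; exists (mobius^`()%classic T).
  exact/cvg_at_left_filter/continuous_dmobius.
- split.
  + move=> u; rewrite in_itv/= => /andP[eu _].
    by case: (is_derive_mobius (lt_trans e0 eu)).
  + exact/cvg_at_right_filter/continuous_mobius.
  + exact/cvg_at_left_filter/continuous_mobius.
- apply: continuous_in_subspaceT => u /[!inE]/=; rewrite in_itv/= => /andP[eu uT].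
  apply: cvgM.
    apply: continuous_powR_affine.
    rewrite (lt_le_trans (mobius_lt T0))// mulNr lerD2l lerN2.
    by rewrite ler_wpM2l// ltW.
  exact/continuous_powRt/(lt_le_trans (mobius_gt0 e0)).
Qed.

Let integrable_kernel_pos e : 0 < e ->
  mu.-integrable `[e, +oo[ (EFin \o power_kernel x c (s - 1) (2 * s)).
Proof.
move=> e0; apply: integrable_power_kernel; rewrite ?den_gt0//.
by move=> c00; move: c0; rewrite c00 ltxx.
Qed.

Let integrable_kernel_neg e : 0 < e -> 0 < x - c * e ->
  mu.-integrable `[e, +oo[ (EFin \o power_kernel x (- c) (s - 1) (2 * s)).
Proof.
move=> e0 xce; apply: integrable_power_kernel ; rewrite ?mulNr//.
by move=> /eqP; rewrite oppr_eq0 gt_eqF.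
Qed.

(** The substitution [u = mobius t] maps [[e, +oo[] onto [[mobius e, x / c[], which
is the part of [[mobius e, +oo[] where the kernel with slope [- c] is not zero.
It is carried out on bounded intervals, away from the singularity at
[x / c]. *)
Lemma power_tail_mobius e : 0 < e ->
  power_tail x c (s - 1) (2 * s) e =
  power_tail x (- c) (s - 1) (2 * s) (mobius e).
Proof.
move=> e0; congr fine; have m0 := mobius_gt0 e0; have me := mobius_lt e0.
have D_sub : positivity_domain x (- c) (mobius e) `<=` `[mobius e, +oo[.
  exact: subIsetl.
have mD := measurable_positivity_domain x (- c) (mobius e).
rewrite [RHS](integral_support mu D_sub); last first.
  by move=> t te nt; exact: power_kernel_out te nt.
pose u n : R := e + n.+1%:R.
have h1 : (\int[mu]_(t in `[e, u n])
    (power_kernel x c (s - 1) (2 * s) t)%:E @[n --> \oo] -->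
    \int[mu]_(t in `[e, +oo[) (power_kernel x c (s - 1) (2 * s) t)%:E)%E.
  apply: integrable_exhaust_cvg => //.
  - by move=> n t /=; rewrite !in_itv/= => /andP[->].
  - move=> t /=; rewrite in_itv/= andbT => et; near=> n.
    rewrite /= in_itv/= et/= (@le_trans _ _ n.+1%:R)//; last by rewrite lerDr ltW.
    rewrite (@le_trans _ _ n%:R) ?ler_nat//.
    by near: n; exact: nbhs_infty_ger.
  - exact: integrable_kernel_pos.
have h2 : (\int[mu]_(t in `[mobius e, mobius (u n)])
    (power_kernel x (- c) (s - 1) (2 * s) t)%:E @[n --> \oo] -->
    \int[mu]_(t in positivity_domain x (- c) (mobius e))
      (power_kernel x (- c) (s - 1) (2 * s) t)%:E)%E.
  apply: integrable_exhaust_cvg => //.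
  - move=> n t /=; rewrite !in_itv/= => /andP[et tT]; split => /=.
      by rewrite in_itv/= et.
    have T0 : 0 < u n by rewrite addr_gt0.
    rewrite (lt_le_trans (mobius_lt T0))// mulNr lerD2l lerN2.
    by rewrite ler_wpM2l// ltW.
  - move=> t [/=]; rewrite in_itv/= andbT => et xct; near=> n.
    have T0 : 0 < u n by rewrite addr_gt0.
    rewrite /= in_itv/= et/= ler_pdivlMr ?den_gt0//.
    rewrite -subr_ge0 (_ : _ - _ = (x + - c * t) * u n - t * x); last by ring.
    rewrite subr_ge0 [leRHS]mulrC -ler_pdivrMr//.
    rewrite (@le_trans _ _ n.+1%:R)//; last by rewrite lerDr ltW.
    rewrite (@le_trans _ _ n%:R) ?ler_nat//.
    by near: n; exact: nbhs_infty_ger.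
  - apply: (@integrableS _ _ _ mu `[mobius e, +oo[) => //.
    exact: integrable_kernel_neg.
suff h3 : (\int[mu]_(t in `[e, u n]) (power_kernel x c (s - 1) (2 * s) t)%:E
    @[n --> \oo] --> \int[mu]_(t in positivity_domain x (- c) (mobius e))
      (power_kernel x (- c) (s - 1) (2 * s) t)%:E)%E.
  exact: cvg_unique h1 h3.
apply: cvg_trans h2; apply: near_eq_cvg; near=> n.
by rewrite subst_mobius// /u ltrDl.
Unshelve. all: by end_near. Qed.

End mobius.

Section reflection.
Context {R : realType}.
Notation mu := (@lebesgue_measure R).
Implicit Types (x c s e : R).

(** After [power_tail_mobius] the difference is an integral over
[[mobius e, e]], an interval of length at most [c / x * e ^ 2]. *)
Let tail_diff_bound x c s e : 0 < x -> 0 < c -> 0 < s -> s < 1 ->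
  0 < e -> c * e <= x / 2 ->
  0 <= power_tail x c (s - 1) (2 * s) e - power_tail x (- c) (s - 1) (2 * s) e
    <= (c / x * (x / 2) `^ (s - 1) * 2^-1 `^ (- (2 * s))) * e `^ (2 - 2 * s).
Proof.
move=> x0 c0 s0 s1 e0 ce; rewrite power_tail_mobius//.
set d := mobius x c e.
have d0 : 0 < d by exact: mobius_gt0.
have de : d <= e by exact: mobius_le.
pose K := power_kernel x (- c) (s - 1) (2 * s).
have xce : 0 < x + - c * e by rewrite mulNr; lra.
have xcd : 0 < x + - c * d by rewrite mulNr; exact: mobius_lt.
have intK : mu.-integrable `[d, +oo[ (EFin \o K).
  apply: integrable_power_kernel => //; [lra|lra|].
  by move=> /eqP; rewrite oppr_eq0 gt_eqF.
have intKe : mu.-integrable `[e, +oo[ (EFin \o K).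
  by apply: integrableS intK => //; apply: subset_itvr; rewrite bnd_simp.
have intKde : mu.-integrable `[d, e] (EFin \o K).
  by apply: integrableS intK => //; exact: subset_itvl.
have -> : power_tail x (- c) (s - 1) (2 * s) d -
    power_tail x (- c) (s - 1) (2 * s) e = \int[mu]_(t in `[d, e]) K t.
  rewrite /power_tail -[X in _ - X](@Rintegral_itv_obnd_cbnd _ e +oo%O); last first.
    by apply: integrableS intKe => //; apply: subset_itvr; rewrite bnd_simp.
  rewrite -(@Rintegral_itvB _ _ (BLeft d) +oo%O e intK) ?bnd_simp//.
  by rewrite subKr.
apply/andP; split.
  by apply: Rintegral_ge0 => t _; exact: power_kernel_ge0.
(* M bounds the kernel because x - c t >= x / 2 and t >= e / 2 on [[d, e]]. *)
pose M := (x / 2) `^ (s - 1) * (2^-1 * e) `^ (- (2 * s)).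
apply: (@le_trans _ _ (\int[mu]_(t in `[d, e]) M)).
  apply: le_Rintegral => //.
    by apply: continuous_compact_integrable;
      [exact: segment_compact|exact/continuous_subspaceT/cst_continuous].
  move=> t /=; rewrite in_itv/= => /andP[dt te].
  have cte : c * t <= c * e by rewrite ler_wpM2l// ltW.
  rewrite /K /power_kernel pos_powerE ?mulNr; last by lra.
  rewrite ler_pM ?powR_ge0// le0_ler_powR//; try lra.
  apply: le_trans dt; rewrite ler_pdivlMr; last by rewrite addr_gt0 ?mulr_gt0.
  rewrite -subr_ge0 (_ : _ - _ = e * (x - c * e) / 2); last by field.
  by rewrite divr_ge0 ?mulr_ge0// ?ltW//; lra.
rewrite Rintegral_cst//= lebesgue_measure_itv/= lte_fin.
have -> : fine (if d < e then (e - d)%:E else 0) = e - d.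
  by case: ltP => //= ed; apply/esym/eqP; rewrite subr_eq0 eq_le ed de.
have ed : e - d <= c / x * e ^+ 2.
  have den : 0 < x + c * e by rewrite addr_gt0 ?mulr_gt0.
  rewrite -subr_ge0 (_ : _ - _ = c ^+ 2 * e ^+ 3 / (x * (x + c * e))); last first.
    by rewrite /d /mobius; field; rewrite !gt_eqF.
  by rewrite divr_ge0 ?mulr_ge0 ?exprn_ge0 ?ltW.
apply: (@le_trans _ _ (M * (c / x * e ^+ 2))).
  by rewrite ler_wpM2l// mulr_ge0 ?powR_ge0.
have -> : M = (x / 2) `^ (s - 1) * (2^-1 `^ (- (2 * s)) * e `^ (- (2 * s))).
  by rewrite /M (@powRM _ 2^-1 e) ?invr_ge0 ?(ltW e0).
rewrite -(powR_mulrn 2 (ltW e0)) (gt0_powRD 2 (- (2 * s)) e0).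
by rewrite le_eqVlt; apply/orP; left; apply/eqP; ring.
Qed.

Lemma power_tail_reflection_cvg x c s : 0 < x -> 0 < s -> s < 1 ->
  power_tail x c (s - 1) (2 * s) e - power_tail x (- c) (s - 1) (2 * s) e
    @[e --> 0^'+] --> 0.
Proof.
move=> x0 s0 s1; wlog c0 : c / 0 <= c.
  move=> h; have [/h//|c0] := leP 0 c.
  have := h (- c); rewrite oppr_ge0 opprK => /(_ (ltW c0)) /cvgN.
  by rewrite oppr0; under eq_cvg do rewrite /= opprB.
move: c0; rewrite le_eqVlt => /predU1P[<-|c0].
  by rewrite oppr0; under eq_cvg do rewrite subrr; exact: cvg_cst.
pose C := c / x * (x / 2) `^ (s - 1) * 2^-1 `^ (- (2 * s)).
apply: (@squeeze_cvgr _ _ _ _ (fun=> 0) (fun e => C * e `^ (2 - 2 * s))).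
- near=> e; apply: tail_diff_bound => //.
  rewrite mulrC -ler_pdivlMr//; near: e; apply: nbhs_right_le.
  by rewrite !divr_gt0.
- exact: cvg_cst.
- rewrite -[X in _ --> X](mulr0 C); apply: cvgM; first exact: cvg_cst.
  by apply: powR_cvg0; lra.
Unshelve. all: by end_near. Qed.

End reflection.

(** * Moments of the central difference *)

Lemma cvg_sum0 {R : realType} {T : Type} {F : set_system T} {FF : Filter F}
    (I : Type) (r : seq I) (f : I -> T -> R) :
  (forall i, f i t @[t --> F] --> 0) ->
  \sum_(i <- r) f i t @[t --> F] --> 0.
Proof.
move=> f0; elim: r => [|i r IH].
  by under eq_fun do rewrite big_nil; exact: cvg_cst.
rewrite -[X in _ --> X]addr0; apply: cvg_trans (cvgD (f0 i) IH).
by apply: near_eq_cvg; apply: nearW => t; rewrite big_cons.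
Qed.

Section moments.
Context {R : realType}.

(** Induction on [p]: one factor [i] is absorbed by
[i * 'C(n.+1, i) = n.+1 * 'C(n, i.-1)], which lowers both [n] and [p]. *)
Lemma alternating_binomial_moment (n p : nat) (c : R) : (p < n)%N ->
  \sum_(i < n.+1) (-1) ^+ i * 'C(n, i)%:R * (i%:R - c) ^+ p = 0.
Proof.
elim: p n c => [|p IH] [//|n] c pn.
  rewrite (eq_bigr (fun i : 'I_n.+2 => (1 ^+ (n.+1 - i) * (-1) ^+ i) *+ 'C(n.+1, i))).
    by rewrite -exprDn subrr expr0n.
  by move=> i _; rewrite expr0 mulr1 expr1n mul1r mulr_natr.
rewrite (eq_bigr (fun i : 'I_n.+2 =>
    (-1) ^+ i * 'C(n.+1, i)%:R * i%:R * (i%:R - c) ^+ p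
    - c * ((-1) ^+ i * 'C(n.+1, i)%:R * (i%:R - c) ^+ p))); last first.
  by move=> i _; rewrite exprS; ring.
rewrite sumrB -mulr_sumr IH ?mulr0 ?subr0; last exact: ltnW.
rewrite big_ord_recl /= mulr0 mul0r add0r.
rewrite (eq_bigr (fun i : 'I_n.+1 =>
    - n.+1%:R * ((-1) ^+ i * 'C(n, i)%:R * (i%:R - (c - 1)) ^+ p))); last first.
  move=> i _; rewrite /bump /= add1n -[_ * i.+1%:R]mulrA -natrM mulnC -mul_bin_diag natrM.
  by rewrite exprS -[i.+1%:R in LHS]natr1 opprB addrA; ring.
by rewrite -mulr_sumr IH ?mulr0.
Qed.

(** Nodes and weights of the central difference of order [2 m + 2], numbered from 0
to [2 m + 2]. *)
Definition node (m j : nat) : R := j%:R - m.+1%:R.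

Definition weight (m j : nat) : R := (-1) ^+ (j + m.+1) * 'C((2 * m).+2, j)%:R.

Lemma weight_moment m p : (p < (2 * m).+2)%N ->
  \sum_(j < (2 * m).+3) weight m j * node m j ^+ p = 0.
Proof.
move=> pm; rewrite (eq_bigr (fun j : 'I_(2 * m).+3 => (-1) ^+ m.+1 *
    ((-1) ^+ j * 'C((2 * m).+2, j)%:R * (j%:R - m.+1%:R) ^+ p))).
  by rewrite -mulr_sumr alternating_binomial_moment// mulr0.
by move=> j _; rewrite /weight /node exprD; ring.
Qed.

Lemma node_rev m (j : 'I_(2 * m).+3) : node m (rev_ord j) = - node m j.
Proof.
have := ltn_ord j; rewrite ltnS => jm.
rewrite /node /= subSS natrB// -!natr1 natrM; ring.
Qed.

Lemma weight_rev m (j : 'I_(2 * m).+3) : weight m (rev_ord j) = weight m j.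
Proof.
have := ltn_ord j; rewrite ltnS => jm.
rewrite /weight /= subSS bin_sub//; congr (_ * _).
rewrite -[LHS]signr_odd -[RHS]signr_odd; congr (_ ^+ nat_of_bool _).
by rewrite !oddD oddB//= oddM; case: (odd j); case: (odd m).
Qed.

End moments.

Section difference_moment.
Context {R : realType}.
Variables (m : nat) (x : R).
Hypothesis x0 : 0 < x.
Implicit Types (p k : nat) (b t : R).

(** The [p]-th derivative of the central difference of [(x + .)^(b+p)] with
respect to the step, up to a constant factor. *)
Definition difference_moment p b t : R :=
  \sum_(j < (2 * m).+3) weight m j * node m j ^+ p * (x + node m j * t) `^ b.

(** Together with [node_affine_bounds] this keeps [x + node m j * t] away from 0, and
so the truncation inactive, for all nodes at once and [t] up to the cut-off
[x / (2 (m + 1))]. *)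
Lemma ler_norm_node (j : 'I_(2 * m).+3) : `|node m j| <= m.+1%:R :> R.
Proof.
have := ltn_ord j; rewrite ltnS => jm.
rewrite ler_norml /node lerBrDr addNr ler0n/= lerBlDr -natrD ler_nat.
by rewrite (leq_trans jm)// mul2n -addnn !addSn addnS.
Qed.

Lemma node_affine_bounds (j : 'I_(2 * m).+3) t :
  0 <= t -> t <= x / (2 * m.+1%:R) ->
  x / 2 <= x + node m j * t <= x * 2.
Proof.
move=> t0 tx.
have : `|node m j * t| <= x / 2.
  rewrite normrM (ger0_norm t0).
  apply: (@le_trans _ _ (m.+1%:R * (x / (2 * m.+1%:R)))).
    by apply: ler_pM => //; exact: ler_norm_node.
  by rewrite invfM mulrCA [_ * (2^-1 * _)]mulrCA divff ?mulr1 ?pnatr_eq0.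
by rewrite ler_norml => /andP[h1 h2]; apply/andP; split; move: x0 => ?; lra.
Qed.

Let node_affine_gt0 (j : 'I_(2 * m).+3) t :
  0 <= t -> t <= x / (2 * m.+1%:R) -> 0 < x + node m j * t.
Proof.
move=> t0 tx; have /andP[+ _] := node_affine_bounds j t0 tx.
by apply: lt_le_trans; rewrite divr_gt0.
Qed.

Let is_derive_difference_moment p b t : 0 <= t -> t <= x / (2 * m.+1%:R) ->
  is_derive t 1 (difference_moment p b) (b * difference_moment p.+1 (b - 1) t).
Proof.
move=> t0 tx.
have dj (j : 'I_(2 * m).+3) := is_deriveZ (weight m j * node m j ^+ p)
  (is_derive_powR_affine b (node_affine_gt0 j t0 tx)).
have := is_derive_sum dj; rewrite fct_sumE.
rewrite [X in is_derive _ _ _ X -> _](_ : _ = b * difference_moment p.+1 (b - 1) t)//.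
rewrite mulr_sumr; apply: eq_bigr => j _.
by rewrite /GRing.scale/= exprS; ring.
Qed.

(** Downward induction on [p] by the mean value theorem: differentiation raises [p]
by one, and as long as [p < 2 m + 2] the vanishing moments give
[difference_moment p b 0 = 0]. *)
Lemma difference_moment_bound k p b : (k + p = (2 * m).+2)%N ->
  exists C : R, forall t, 0 <= t -> t <= x / (2 * m.+1%:R) ->
    `|difference_moment p b t| <= C * t ^+ k.
Proof.
elim: k p b => [|k IH] p b kp.
  exists (\sum_(j < (2 * m).+3) `|weight m j * node m j ^+ p| *
    ((x / 2) `^ b + (x * 2) `^ b)).
  move=> t t0 tx; rewrite expr0 mulr1 (le_trans (ler_norm_sum _ _ _))//.
  apply: ler_sum => j _; rewrite normrM ler_wpM2l//.
  rewrite ger0_norm ?powR_ge0//.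
  have /andP[h1 h2] := node_affine_bounds j t0 tx.
  by apply: powR_le_endpoints => //; rewrite divr_gt0.
have [C hC] := IH p.+1 (b - 1) (etrans (addnS _ _) kp).
have C0 : 0 <= C.
  have x1 : 0 < x / (2 * m.+1%:R) by rewrite divr_gt0// mulr_gt0.
  have := le_trans (normr_ge0 _) (hC _ (ltW x1) (lexx _)).
  by rewrite pmulr_lge0// exprn_gt0.
exists (`|b| * C) => t t0 tx.
have h0 : difference_moment p b 0 = 0.
  rewrite /difference_moment; under eq_bigr do rewrite mulr0 addr0.
  by rewrite -mulr_suml weight_moment ?mul0r// -kp addSn ltnS leq_addl.
have [||z zt] := @MVT_segment R (difference_moment p b)
  (fun z => b * difference_moment p.+1 (b - 1) z) 0 t t0.
- move=> z; rewrite in_itv/= => /andP[z0 zt].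
  by apply: is_derive_difference_moment; [exact: ltW|exact/ltW/(lt_le_trans zt)].
- apply: derivable_within_continuous => z; rewrite in_itv/= => /andP[z0 zt].
  by case: (is_derive_difference_moment p b z0 (le_trans zt tx)).
move: zt; rewrite in_itv/= => /andP[z0 zt].
rewrite h0 !subr0 => ->; rewrite !normrM (ger0_norm t0) exprSr !mulrA.
rewrite ler_wpM2r// -mulrA ler_wpM2l//.
apply: (le_trans (hC _ z0 (le_trans zt tx))).
by rewrite ler_wpM2l// lerXn2r.
Qed.

(** This disposes of the boundary terms of all integrations by parts. *)
Lemma difference_moment_cvg0 p b (r : R) : (p <= (2 * m).+2)%N ->
  r < ((2 * m).+2 - p)%:R ->
  difference_moment p b e * e `^ (- r) @[e --> 0^'+] --> 0.
Proof.
move=> pm rm; have [C hC] := difference_moment_bound b (subnK pm).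
apply/norm_cvg0P.
apply: (@squeeze_cvgr _ _ _ _ (fun=> 0) (fun e => C * e `^ (((2 * m).+2 - p)%:R - r))).
- near=> e; have e0 : 0 < e by [].
  rewrite normr_ge0/= normrM (ger0_norm (powR_ge0 _ _)) gt0_powRD// mulrA.
  rewrite ler_wpM2r ?powR_ge0// powR_mulrn ?(ltW e0)// hC ?(ltW e0)//.
  by near: e; apply: nbhs_right_le; rewrite divr_gt0// mulr_gt0.
- exact: cvg_cst.
- rewrite -[X in _ --> X](mulr0 C); apply: cvgM; first exact: cvg_cst.
  by apply: powR_cvg0; rewrite subr_gt0.
Unshelve. all: by end_near. Qed.

Lemma near_node_affine_gt0 : \forall e \near 0^'+,
  forall j : 'I_(2 * m).+3, 0 < x + node m j * e.
Proof.
near=> e => j; apply: node_affine_gt0; first by apply: ltW.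
by near: e; apply: nbhs_right_le; rewrite divr_gt0// mulr_gt0.
Unshelve. all: by end_near. Qed.

End difference_moment.

(** * Cancellation in the limit of vanishing cut-off *)

Section difference_tail.
Context {R : realType}.
Variables (m : nat) (x sigma : R).
Hypotheses (x0 : 0 < x) (sigma0 : 0 < sigma) (sigma1 : sigma < 1).
Notation s := (m%:R + sigma).
Implicit Types (p k : nat) (a q e : R).

Definition difference_tail p a q e : R :=
  \sum_(j < (2 * m).+3) weight m j * node m j ^+ p * power_tail x (node m j) a q e.

(** The exponent that is left after [p] integrations by parts starting from the
largest admissible one, [2 m + sigma]. *)
Let top_exponent p : R := (2 * m)%:R + sigma - p%:R.

Let difference_tail_parts p : (p <= 2 * m)%N -> \forall e \near 0^'+,
  (2 * s - p%:R) * difference_tail p (top_exponent p) (1 + 2 * s - p%:R) e =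
  top_exponent p *
    difference_tail p.+1 (top_exponent p.+1) (1 + 2 * s - p.+1%:R) e +
  difference_moment m x p (top_exponent p) e * e `^ (- (2 * s - p%:R)).
Proof.
move=> pm; near=> e.
have e0 : 0 < e by [].
have xce (j : 'I_(2 * m).+3) : 0 < x + node m j * e.
  by move: j; near: e; exact: near_node_affine_gt0.
have pm' : p%:R <= (2 * m)%:R :> R by rewrite ler_nat.
have m2 : (2 * m)%:R = 2 * m%:R :> R by rewrite natrM.
have a0 : 0 < top_exponent p by rewrite /top_exponent; move: sigma0 => ?; lra.
have aq : top_exponent p < 2 * s - p%:R.
  by rewrite /top_exponent m2; move: sigma0 => ?; lra.
rewrite /difference_moment mulr_suml !mulr_sumr -big_split/=.
apply: eq_bigr => j _.
(* Up to the form of the exponents this is the identity of each term. *)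
have := power_tail_parts x0 e0 (xce j) a0 aq.
rewrite (_ : 2 * s - p%:R + 1 = 1 + 2 * s - p%:R); last by ring.
rewrite (_ : top_exponent p - 1 = top_exponent p.+1); last first.
  by rewrite /top_exponent -natr1; ring.
rewrite (_ : 1 + 2 * s - p.+1%:R = 2 * s - p%:R); last by rewrite -natr1; ring.
move=> h; rewrite mulrCA h exprSr; ring.
Unshelve. all: by end_near. Qed.

(** The odd power of the nodes makes the sum antisymmetric under the exchange of
opposite nodes, so it is half the sum of the differences controlled by
[power_tail_reflection_cvg]. *)
Let difference_tail_last :
  difference_tail (2 * m).+1 (top_exponent (2 * m).+1)
    (1 + 2 * s - (2 * m).+1%:R) e @[e --> 0^'+] --> 0.
Proof.
have -> : top_exponent (2 * m).+1 = sigma - 1.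
  by rewrite /top_exponent -natr1; ring.
have -> : 1 + 2 * s - (2 * m).+1%:R = 2 * sigma.
  by rewrite -[(2 * m).+1%:R]natr1 natrM; ring.
set F := difference_tail _ _ _.
have FE e : F e = 2^-1 * \sum_(j < (2 * m).+3)
    weight m j * node m j ^+ (2 * m).+1 *
    (power_tail x (node m j) (sigma - 1) (2 * sigma) e -
     power_tail x (- node m j) (sigma - 1) (2 * sigma) e).
  have FN : F e = - \sum_(j < (2 * m).+3) weight m j * node m j ^+ (2 * m).+1 *
      power_tail x (- node m j) (sigma - 1) (2 * sigma) e.
    rewrite /F /difference_tail (reindex_inj rev_ord_inj) -sumrN.
    apply: eq_bigr => j _; rewrite node_rev weight_rev exprNn.
    by rewrite -[(-1) ^+ _]signr_odd /= oddM /= expr1; ring.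
  under eq_bigr do rewrite mulrBr.
  by rewrite sumrB -[X in X - _]/(F e) -[X in _ - X]opprK -FN; field.
have h : 2^-1 * \sum_(j < (2 * m).+3)
    weight m j * node m j ^+ (2 * m).+1 *
    (power_tail x (node m j) (sigma - 1) (2 * sigma) e -
     power_tail x (- node m j) (sigma - 1) (2 * sigma) e) @[e --> 0^'+] --> 0.
  rewrite -[X in _ --> X](mulr0 2^-1); apply: cvgM; first exact: cvg_cst.
  apply: cvg_sum0 => j.
  rewrite -[X in _ --> X](mulr0 (weight m j * node m j ^+ (2 * m).+1)).
  apply: cvgM; first exact: cvg_cst.
  exact: power_tail_reflection_cvg.
apply: cvg_trans h.
by apply: near_eq_cvg; apply: nearW => e; rewrite FE.
Qed.

(** By induction on the number [k] of integrations by parts that are undone. *)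
Let difference_tail_top k : (k <= (2 * m).+1)%N ->
  let p := ((2 * m).+1 - k)%N in
  difference_tail p (top_exponent p) (1 + 2 * s - p%:R) e @[e --> 0^'+] --> 0.
Proof.
elim: k => [_|k IH km]; first by rewrite subn0; exact: difference_tail_last.
have {IH} := IH (ltnW km).
have -> : ((2 * m).+1 - k = ((2 * m).+1 - k.+1).+1)%N by rewrite -subSn// subSS.
set p := ((2 * m).+1 - k.+1)%N => IH /=.
have pm : (p <= 2 * m)%N by rewrite /p subSS leq_subr.
have pm' : p%:R <= (2 * m)%:R :> R by rewrite ler_nat.
have m2 : (2 * m)%:R = 2 * m%:R :> R by rewrite natrM.
have q0 : 0 < 2 * s - p%:R by move: sigma0 => ?; lra.
have mom : difference_moment m x p (top_exponent p) e * e `^ (- (2 * s - p%:R))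
    @[e --> 0^'+] --> 0.
  have pm2 : (p <= (2 * m).+2)%N by rewrite (leq_trans pm)// ltnW.
  apply: difference_moment_cvg0 => //.
  rewrite (natrB _ pm2) (_ : (2 * m).+2%:R = 2 * m%:R + 2 :> R) ?mulrDr.
    by move: sigma1 => ?; lra.
  by rewrite -addn2 natrD natrM.
have h : (2 * s - p%:R)^-1 * (top_exponent p *
    difference_tail p.+1 (top_exponent p.+1) (1 + 2 * s - p.+1%:R) e +
    difference_moment m x p (top_exponent p) e * e `^ (- (2 * s - p%:R)))
    @[e --> 0^'+] --> 0.
  rewrite -[X in _ --> X](mulr0 (2 * s - p%:R)^-1); apply: cvgM; first exact: cvg_cst.
  rewrite -[X in _ --> X]addr0; apply: cvgD => //.
  by rewrite -[X in _ --> X](mulr0 (top_exponent p)); apply: cvgM => //; exact: cvg_cst.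
apply: cvg_trans h; apply: near_eq_cvg.
have := difference_tail_parts pm; apply: filterS => e <-.
by rewrite mulKf// gt_eqF.
Qed.

(** [power_tail_recurrence] expresses the combination of exponent [a - 1] by the one
of exponent [a] and a boundary term; the factor [a * x] to be divided out is
positive, as the step from [i + 1] to [i] has [a = i + sigma]. *)
Let difference_tail_down k : (k <= (2 * m).+1)%N ->
  difference_tail 0 (((2 * m).+1 - k)%:R + sigma - 1) (1 + 2 * s) e
    @[e --> 0^'+] --> 0.
Proof.
elim: k => [_|k IH km].
  have := difference_tail_top (leqnn _); rewrite /= subnn subn0 subr0.
  rewrite /top_exponent subr0 (_ : _ + _ - 1 = (2 * m)%:R + sigma)//.
  by rewrite -natr1; ring.
have {IH} := IH (ltnW km).
have -> : ((2 * m).+1 - k = ((2 * m).+1 - k.+1).+1)%N by rewrite -subSn// subSS.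
set i := ((2 * m).+1 - k.+1)%N => IH.
have im : i%:R <= (2 * m)%:R :> R by rewrite ler_nat /i subSS leq_subr.
have i0 : 0 <= i%:R :> R by [].
have m2 : (2 * m)%:R = 2 * m%:R :> R by rewrite natrM.
pose a := i.+1%:R + sigma - 1.
have aE : a = i%:R + sigma by rewrite /a -natr1; ring.
have a0 : 0 < a by rewrite aE; move: sigma0 => ?; lra.
have aq : a < 2 * s by rewrite aE; move: sigma0 => ?; lra.
rewrite -/a in IH.
have mom : difference_moment m x 0 a e * e `^ (- (2 * s)) @[e --> 0^'+] --> 0.
  apply: difference_moment_cvg0 => //.
  rewrite subn0 (_ : (2 * m).+2%:R = 2 * m%:R + 2 :> R) ?mulrDr.
    by move: sigma1 => ?; lra.
  by rewrite -addn2 natrD natrM.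
have h : (a * x)^-1 * (difference_moment m x 0 a e * e `^ (- (2 * s)) -
    (2 * s - a) * difference_tail 0 a (1 + 2 * s) e) @[e --> 0^'+] --> 0.
  rewrite -[X in _ --> X](mulr0 (a * x)^-1); apply: cvgM; first exact: cvg_cst.
  rewrite -[X in _ --> X]subr0; apply: cvgB => //.
  by rewrite -[X in _ --> X](mulr0 (2 * s - a)); apply: cvgM => //; exact: cvg_cst.
apply: cvg_trans h; apply: near_eq_cvg; near=> e.
have e0 : 0 < e by [].
have xce (j : 'I_(2 * m).+3) : 0 < x + node m j * e.
  by move: j; near: e; exact: near_node_affine_gt0.
rewrite -aE.
apply: (@mulfI _ (a * x)); first by rewrite gt_eqF// mulr_gt0.
rewrite mulVKf; last by rewrite gt_eqF// mulr_gt0.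
rewrite /difference_moment mulr_suml !mulr_sumr -sumrB.
apply: eq_bigr => j _.
rewrite -[_ * e `^ _]mulrA -(power_tail_recurrence x0 e0 (xce j) a0 aq) [2 * s + 1]addrC.
by ring.
Unshelve. all: by end_near. Qed.

Lemma difference_tail_cvg0 k : (k <= 2 * m + 1)%N ->
  difference_tail 0 (k%:R + sigma - 1) (1 + 2 * s) e @[e --> 0^'+] --> 0.
Proof.
rewrite addn1 => km; have := difference_tail_down (leq_subr k _).
by rewrite subKn.
Qed.

End difference_tail.

(** * The integral over the line *)

Lemma integrable_setU_disjoint d (T : measurableType d) (R : realType)
    (mu : {measure set T -> \bar R}) (A B : set T) (f : T -> \bar R) :
  measurable A -> measurable B -> [disjoint A & B] ->
  mu.-integrable A f -> mu.-integrable B f -> mu.-integrable (A `|` B) f.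
Proof.
move=> mA mB AB /integrableP[mfA fA] /integrableP[mfB fB].
have mf : measurable_fun (A `|` B) f by apply/measurable_funU.
apply/integrableP; split => //.
rewrite ge0_integral_setU//; first exact: lte_add_pinfty.
exact: measurableT_comp.
Qed.

Section half_line.
Context {R : realType}.
Notation mu := (@lebesgue_measure R).

Lemma integrable_half_line (f : R -> R) (e : R) : 0 < e ->
  mu.-integrable `]0, e] (EFin \o f) -> mu.-integrable `[e, +oo[ (EFin \o f) ->
  mu.-integrable `]0, +oo[ (EFin \o f).
Proof.
move=> e0 f0 fe.
rewrite (@itv_bndbnd_setU _ _ (BRight 0) (BRight e) +oo%O) ?bnd_simp ?ltW//.
apply: integrable_setU_disjoint => //.
- apply/disj_setPS => t [/=]; rewrite !in_itv/= andbT => /andP[_ te].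
  by rewrite ltNge te.
- by apply: integrableS fe => //; apply: subset_itvr; rewrite bnd_simp.
Qed.

(** Stated for measurable functions, since a truncated power may be discontinuous
or unbounded at the end of its support. *)
Lemma ge0_even_integral (g : R -> \bar R) : measurable_fun [set: R] g ->
  (forall t, 0 <= g t)%E -> (forall t, g (- t) = g t) ->
  (\int[mu]_t g t = \int[mu]_(t in `]0%R, +oo[) g t +
                    \int[mu]_(t in `]0%R, +oo[) g t)%E.
Proof.
move=> mg g0 gN.
have -> : [set: R] = `]-oo, 0] `|` `]0, +oo[.
  by rewrite -(@itv_bndbnd_setU _ _ -oo%O (BRight 0) +oo%O) ?set_itvE.
rewrite ge0_integral_setU//; last 2 first.
- exact: measurable_funTS.
- apply/disj_setPS => t [/=]; rewrite !in_itv/= andbT => te.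
  by rewrite ltNge te.
congr (_ + _)%E.
rewrite integral_itv_obnd_cbnd; last exact: measurable_funTS.
rewrite (ge0_integration_by_substitution0 mg g0).
by apply: eq_integral => t _; rewrite gN.
Qed.

Lemma integrable_even (f : R -> R) : measurable_fun [set: R] f ->
  (forall t, f (- t) = f t) -> mu.-integrable `]0, +oo[ (EFin \o f) ->
  mu.-integrable [set: R] (EFin \o f).
Proof.
move=> mf fN /integrableP[_ intf].
have mEf : measurable_fun [set: R] (EFin \o f) by exact/measurable_EFinP.
apply/integrableP; split => //.
rewrite (@ge0_even_integral (abse \o (EFin \o f))).
- exact: lte_add_pinfty.
- exact: measurableT_comp.
- by move=> t; exact: abse_ge0.
- by move=> t /=; rewrite fN.
Qed.

Lemma integral_even (f : R -> R) : measurable_fun [set: R] f ->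
  (forall t, f (- t) = f t) -> mu.-integrable `]0, +oo[ (EFin \o f) ->
  (\int[mu]_t (f t)%:E = \int[mu]_(t in `]0%R, +oo[) (f t)%:E +
                         \int[mu]_(t in `]0%R, +oo[) (f t)%:E)%E.
Proof.
move=> mf fN intf.
have mEf : measurable_fun [set: R] (EFin \o f) by exact/measurable_EFinP.
have fp : (\int[mu]_(t in `]0%R, +oo[) (EFin \o f)^\+ t \is a fin_num)%E.
  by apply: integrable_fin_num => //; exact: integrable_funepos.
have fn : (\int[mu]_(t in `]0%R, +oo[) (EFin \o f)^\- t \is a fin_num)%E.
  by apply: integrable_fin_num => //; exact: integrable_funeneg.
rewrite integralE [X in (_ = X + X)%E]integralE.
rewrite (@ge0_even_integral (EFin \o f)^\+)%E; last 3 first.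
- exact: measurable_funepos.
- exact: funepos_ge0.
- by move=> t; rewrite !funeposE /= fN.
rewrite (@ge0_even_integral (EFin \o f)^\-)%E; last 3 first.
- exact: measurable_funeneg.
- exact: funeneg_ge0.
- by move=> t; rewrite !funenegE /= fN.
by rewrite fin_num_oppeD// addeACA.
Qed.

End half_line.

Section line_integral.
Context {R : realType}.
Notation mu := (@lebesgue_measure R).
Variables (m : nat) (x sigma : R) (k : nat).
Hypotheses (x0 : 0 < x) (sigma0 : 0 < sigma) (sigma1 : sigma < 1).
Hypothesis km : (k <= 2 * m + 1)%N.
Notation s := (m%:R + sigma).
Notation a := (k%:R + sigma - 1).
Notation q := (1 + 2 * s).

Definition line_difference t : R :=
  \sum_(j < (2 * m).+3) weight m j * pos_power (x + node m j * t) a.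

Definition line_kernel t : R := line_difference t * `|t| `^ (- q).

Let km' : k%:R <= 2 * m%:R + 1 :> R.
Proof. by rewrite -natrM -(natrD _ _ 1) ler_nat. Qed.

Let k0 : 0 <= k%:R :> R. Proof. by []. Qed.

Let m0 : 0 <= m%:R :> R. Proof. by []. Qed.

Let aN1 : -1 < a. Proof. by move: sigma0 k0 => ? ?; lra. Qed.

Let aq : 1 + a < q. Proof. by move: sigma0 km' => ? ?; lra. Qed.

Let q1 : 1 < q. Proof. by move: sigma0 m0 => ? ?; lra. Qed.

Lemma measurable_line_difference : measurable_fun [set: R] line_difference.
Proof.
apply: measurable_sum => j; apply: measurable_funM => //.
exact: (measurableT_comp (measurable_pos_power a) (measurable_affine x _)).
Qed.

Lemma measurable_line_kernel : measurable_fun [set: R] line_kernel.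
Proof.
apply: measurable_funM; first exact: measurable_line_difference.
exact: (measurableT_comp (measurable_powR _) (@normr_measurable R setT)).
Qed.

Lemma line_kernelN t : line_kernel (- t) = line_kernel t.
Proof.
rewrite /line_kernel normrN; congr (_ * _).
rewrite /line_difference (reindex_inj rev_ord_inj).
by apply: eq_bigr => j _; rewrite node_rev weight_rev mulrNN.
Qed.

(** The weights sum to zero. *)
Lemma line_difference0 : line_difference 0 = 0.
Proof.
rewrite /line_difference; under eq_bigr do rewrite mulr0 addr0.
rewrite -mulr_suml (eq_bigr (fun j : 'I_(2 * m).+3 => weight m j * node m j ^+ 0)).
  by rewrite weight_moment ?mul0r.
by move=> j _; rewrite expr0 mulr1.
Qed.

Let line_kernel_tailE e t : 0 < e -> `[e, +oo[%classic t ->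
  line_kernel t =
  \sum_(j < (2 * m).+3) weight m j * power_kernel x (node m j) a q t.
Proof.
move=> e0; rewrite /= in_itv/= andbT => et; have t0 := lt_le_trans e0 et.
rewrite /line_kernel gtr0_norm// mulr_suml.
by apply: eq_bigr => j _; rewrite -mulrA.
Qed.

Let integrable_scaled_kernel e : 0 < e ->
    (forall j : 'I_(2 * m).+3, 0 < x + node m j * e) -> forall j : 'I_(2 * m).+3,
  mu.-integrable `[e, +oo[
    (fun t => (weight m j * power_kernel x (node m j) a q t)%:E).
Proof.
move=> e0 xce j; apply: integrable_scale => //.
exact: integrable_power_kernel.
Qed.

Let integrable_line_kernel_tail e : 0 < e ->
    (forall j : 'I_(2 * m).+3, 0 < x + node m j * e) ->
  mu.-integrable `[e, +oo[ (EFin \o line_kernel).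
Proof.
move=> e0 xce.
have : mu.-integrable `[e, +oo[ (fun t => \sum_(j < (2 * m).+3)
    (weight m j * power_kernel x (node m j) a q t)%:E)%E.
  by apply: integrable_sum => // j _; exact: integrable_scaled_kernel.
apply: eq_integrable => // t; rewrite inE => te.
by rewrite /= (line_kernel_tailE e0 te) -sumEFin.
Qed.

Let integral_line_kernel_tail e : 0 < e ->
    (forall j : 'I_(2 * m).+3, 0 < x + node m j * e) ->
  (\int[mu]_(t in `[e, +oo[) (line_kernel t)%:E =
  (difference_tail m x 0 a q e)%:E)%E.
Proof.
move=> e0 xce.
transitivity (\int[mu]_(t in `[e, +oo[) \sum_(j < (2 * m).+3)
    (weight m j * power_kernel x (node m j) a q t)%:E)%E.
  apply: eq_integral => t; rewrite inE => te.
  by rewrite (line_kernel_tailE e0 te) -sumEFin.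
rewrite integral_sum//; last first.
  by move=> j; exact: integrable_scaled_kernel.
rewrite /difference_tail -sumEFin; apply: eq_bigr => j _.
rewrite expr0 mulr1 /power_tail -RintegralZl//; last exact: integrable_power_kernel.
rewrite /Rintegral fineK//.
by apply: integrable_fin_num => //; exact: integrable_scaled_kernel.
Qed.

Let cutoff : R := x / (2 * m.+1%:R).

Let cutoff_gt0 : 0 < cutoff.
Proof. by rewrite divr_gt0// mulr_gt0. Qed.

Let cutoff_gt0' e : 0 <= e -> e <= cutoff ->
  forall j : 'I_(2 * m).+3, 0 < x + node m j * e.
Proof.
move=> e0 ec j; have /andP[+ _] := node_affine_bounds x0 j e0 ec.
by apply: lt_le_trans; rewrite divr_gt0.
Qed.

(** The kernel is [O(t ^ (2 m + 2 - (1 + 2 s)))], and this exponent is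
[1 - 2 sigma > -1]. *)
Let integrable_line_kernel_0 : mu.-integrable `]0, cutoff] (EFin \o line_kernel).
Proof.
have [C hC] := difference_moment_bound x0 a (addn0 (2 * m).+2).
apply: (@le_integrable _ _ _ mu _ _ _
  (fun t => (C * t `^ ((2 * m).+2%:R - q))%:E)) => //.
- apply/measurable_EFinP; apply: measurable_funTS.
  exact: measurable_line_kernel.
- move=> t /=; rewrite in_itv/= => /andP[t0 tc].
  have -> : line_kernel t = difference_moment m x 0 a t * t `^ (- q).
    rewrite /line_kernel gtr0_norm//; congr (_ * _); apply: eq_bigr => j _.
    by rewrite expr0 mulr1 pos_powerE//; apply: cutoff_gt0' => //; exact: ltW.
  rewrite lee_fin normrM (ger0_norm (powR_ge0 t (- q))) (le_trans _ (ler_norm _))//.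
  rewrite gt0_powRD// powR_mulrn ?(ltW t0)// mulrA ler_wpM2r ?powR_ge0//.
  by apply: hC => //; exact: ltW.
- apply: integrable_scale => //; apply: integrable_powR_0 => //.
  rewrite (_ : (2 * m).+2%:R = 2 * m%:R + 2 :> R) ?mulrDr.
    by move: sigma1 => ?; lra.
  by rewrite -addn2 natrD natrM.
Qed.

Let integrable_line_kernel_half : mu.-integrable `]0, +oo[ (EFin \o line_kernel).
Proof.
apply: (integrable_half_line cutoff_gt0) => //.
apply: integrable_line_kernel_tail => //; apply: cutoff_gt0' => //.
exact: ltW.
Qed.

(** The integral is the limit of the tails beyond [e n], that is of
[difference_tail] at cut-offs tending to 0. *)
Let integral_line_kernel_half :
  (\int[mu]_(t in `]0%R, +oo[) (line_kernel t)%:E = 0)%E.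
Proof.
pose e n : R := cutoff * n.+1%:R^-1.
have e0 n : 0 < e n by rewrite mulr_gt0.
have ec n : e n <= cutoff.
  by rewrite ger_pMr// invf_le1// ler1n.
have ecv : e n @[n --> \oo] --> 0.
  rewrite -[X in _ --> X](mulr0 cutoff); apply: cvgM; first exact: cvg_cst.
  exact: cvg_harmonic.
have h : (\int[mu]_(t in `[e n, +oo[) (line_kernel t)%:E @[n --> \oo] -->
    \int[mu]_(t in `]0%R, +oo[) (line_kernel t)%:E)%E.
  apply: integrable_exhaust_cvg => //.
  - by move=> n t /=; rewrite !in_itv/= !andbT; exact: lt_le_trans.
  - move=> t /=; rewrite in_itv/= andbT => t0; near=> n.
    rewrite /= in_itv/= andbT; apply: ltW; near: n.
    by move/cvgrPdist_lt : ecv => /(_ _ t0); apply: filterS => n /=;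
      rewrite sub0r normrN => /(le_lt_trans (ler_norm _)).
have h' : (\int[mu]_(t in `[e n, +oo[) (line_kernel t)%:E @[n --> \oo] --> 0)%E.
  under eq_fun do rewrite (integral_line_kernel_tail (e0 _) (cutoff_gt0' (ltW (e0 _)) (ec _))).
  apply: cvg_EFin; first exact: nearW.
  have := difference_tail_cvg0 x0 sigma0 sigma1 km.
  by move/cvg_at_rightP; apply.
exact: cvg_unique h h'.
Unshelve. all: by end_near. Qed.

Lemma integrable_line_kernel : mu.-integrable [set: R] (EFin \o line_kernel).
Proof.
by apply: integrable_even => //; [exact: measurable_line_kernel|exact: line_kernelN].
Qed.

Lemma integral_line_kernel : (\int[mu]_t (line_kernel t)%:E = 0)%E.
Proof.
have mK := measurable_line_kernel.
by rewrite (integral_even mK line_kernelN)// integral_line_kernel_half adde0.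
Qed.

End line_integral.

(** * Integrating out the tangential variables *)

Section radial_kernel.
Context {R : realType}.
Notation mu := (@lebesgue_measure R).
Implicit Types (A r q t : R).

Let measurable_cauchy_kernel A q :
  measurable_fun [set: R] (fun t => (A + t ^+ 2) `^ (- q)).
Proof.
apply: (measurableT_comp (measurable_powR _)).
by apply: measurable_funD => //; exact: measurable_funX.
Qed.

(** Compare with 1 on [[0, 1]] and with [t ^ (- 2 q)] beyond 1. *)
Let integrable_cauchy_kernel q : 2^-1 < q ->
  mu.-integrable `]0, +oo[ (EFin \o (fun t => (1 + t ^+ 2) `^ (- q))).
Proof.
move=> q2; have mk D : measurable_fun D (EFin \o (fun t : R => (1 + t ^+ 2) `^ (- q))).
  by apply/measurable_EFinP; apply: measurable_funTS; exact: measurable_cauchy_kernel.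
apply: (@integrable_half_line _ _ 1) => //.
- apply: (@le_integrable _ _ _ mu _ _ _ (EFin \o (fun t => t `^ 0))) => //.
    exact: mk.
    move=> t _; rewrite lee_fin powRr0 normr1 ger0_norm ?powR_ge0//.
    have := @le0_ler_powR R (- q) 1 (1 + t ^+ 2); rewrite powR1.
    by apply => //; [lra|rewrite lerDl sqr_ge0].
  by apply: integrable_powR_0 => //; lra.
- apply: (@le_integrable _ _ _ mu _ _ _ (EFin \o (fun t => t `^ (- (2 * q))))) => //.
    exact: mk.
    move=> t /=; rewrite in_itv/= andbT => t1; have t0 : 0 < t by apply: lt_le_trans t1.
    rewrite lee_fin !ger0_norm ?powR_ge0// -mulrN powRrM.
    rewrite (_ : t `^ 2 = t ^+ 2) ?powR_mulrn ?(ltW t0)//.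
    apply: le0_ler_powR; [by lra|by rewrite exprn_gt0|].
    by rewrite lerDr.
  by apply: integrable_powR_ygt1 => //; lra.
Qed.

(** Substitute [sqrt A * t] for [t]. *)
Let integral_cauchy_scale A q : 0 < A ->
  (\int[mu]_(t in `[0%R, +oo[) ((A + t ^+ 2) `^ (- q))%:E =
   (A `^ (2^-1 - q))%:E *
   \int[mu]_(t in `[0%R, +oo[) ((1 + t ^+ 2) `^ (- q))%:E)%E.
Proof.
move=> A0; pose b := Num.sqrt A.
have b0 : 0 < b by rewrite sqrtr_gt0.
have db t : is_derive t 1 (fun t => b * t) b.
  by apply: is_derive_eq; rewrite /GRing.scale/= mulr1.
have d1 : derive1 (fun t => b * t) = cst b.
  by apply/funext => t; rewrite derive1E; case: (db t).
have cb t : {for t, continuous (fun t => b * t)}.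
  by apply: cvgM; [exact: cvg_cst|exact: cvg_id].
have := @increasing_ge0_integration_by_substitutiony R (fun t => b * t)
  (fun t => (A + t ^+ 2) `^ (- q)) 0.
rewrite mulr0 => ->; first last.
- by move=> t _; exact: powR_ge0.
- apply: continuous_subspaceT => t.
  apply: (@continuous_comp _ _ _ (fun t => A + t ^+ 2) (fun y => y `^ (- q))).
    by apply: cvgD; [exact: cvg_cst|exact: exprn_continuous].
  by apply: continuous_powRt; rewrite ltr_pwDl// sqr_ge0.
- by apply: gt0_cvgMry => //; exact: cvg_id.
- split; first by move=> t _; case: (db t).
  exact/cvg_at_right_filter/cb.
- by rewrite d1; apply: is_cvg_cst.
- by rewrite d1; apply: is_cvg_cst.
- by move=> t _; rewrite d1; exact: cst_continuous.
- by move=> t u _ _ tu; rewrite ltr_pM2l.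
rewrite -ge0_integralZl_EFin//; last 3 first.
- by move=> t _; rewrite lee_fin powR_ge0.
- by apply/measurable_EFinP; apply: measurable_funTS; exact: measurable_cauchy_kernel.
- exact: powR_ge0.
apply: eq_integral => t _; rewrite -EFinM; congr EFin.
rewrite -[LHS]/((A + (b * t) ^+ 2) `^ (- q) * derive1 (fun t => b * t) t).
rewrite d1 /= exprMn sqr_sqrtr ?(ltW A0)//.
rewrite -{1}(mulr1 A) -mulrDr powRM ?(ltW A0)//; last by rewrite addr_ge0 ?sqr_ge0.
by rewrite /b -powR12_sqrt ?(ltW A0)// mulrAC -gt0_powRD// addrC.
Qed.

Let integral_cauchy_kernel q : 2^-1 < q -> exists2 C : R, 0 <= C &
  forall A, 0 < A ->
    (\int[mu]_t ((A + t ^+ 2) `^ (- q))%:E = (C * A `^ (2^-1 - q))%:E)%E.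
Proof.
move=> q2.
have ik := integrable_cauchy_kernel q2.
pose I := \int[mu]_(t in `]0, +oo[) (1 + t ^+ 2) `^ (- q).
exists (I + I).
  by rewrite addr_ge0 ?Rintegral_ge0// => t _; exact: powR_ge0.
move=> A A0.
rewrite (@ge0_even_integral _ (fun t => ((A + t ^+ 2) `^ (- q))%:E)).
- rewrite integral_itv_obnd_cbnd; last first.
    by apply/measurable_EFinP; apply: measurable_funTS; exact: measurable_cauchy_kernel.
  rewrite integral_cauchy_scale//.
  rewrite -integral_itv_obnd_cbnd; last first.
    by apply/measurable_EFinP; apply: measurable_funTS; exact: measurable_cauchy_kernel.
  have -> : (\int[mu]_(t in `]0%R, +oo[) ((1 + t ^+ 2) `^ (- q))%:E = I%:E)%E.
    by rewrite /I /Rintegral fineK//; exact: integrable_fin_num.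
  by rewrite -EFinM -EFinD; congr EFin; ring.
- by apply/measurable_EFinP; exact: measurable_cauchy_kernel.
- by move=> t; rewrite lee_fin powR_ge0.
- by move=> t; rewrite sqrrN.
Qed.

Definition sqnorm n (w : 'rV[R]_n) : R := \sum_(i < n) w 0 i ^+ 2.

Lemma sqnorm_ge0 n (w : 'rV[R]_n) : 0 <= sqnorm w.
Proof. by apply: sumr_ge0 => i _; exact: sqr_ge0. Qed.

Lemma measurable_sqnorm n : measurable_fun [set: 'rV[R]_n] (@sqnorm n).
Proof.
apply: measurable_sum => i; apply: measurable_funX; exact: measurable_coord.
Qed.

Lemma sqnorm_cons n t (w : 'rV[R]_n) : sqnorm (cons_rV (t, w)) = t ^+ 2 + sqnorm w.
Proof.
rewrite /sqnorm big_ord_recl mxE unlift_none; congr (_ + _).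
by apply: eq_bigr => i _; rewrite mxE liftK.
Qed.

Lemma measurable_sqnorm_power n A r :
  measurable_fun [set: 'rV[R]_n] (fun w => (A + sqnorm w) `^ (- r)).
Proof.
apply: (measurableT_comp (measurable_powR _)).
by apply: measurable_funD => //; exact: measurable_sqnorm.
Qed.

Lemma measurable_cons_power n A r :
  measurable_fun [set: measurableTypeR R * 'rV[R]_n]
    (fun p => (A + (p.1 ^+ 2 + sqnorm p.2)) `^ (- r)).
Proof.
under eq_fun do rewrite -sqnorm_cons -surjective_pairing.
exact: (measurableT_comp (measurable_sqnorm_power A r) (@measurable_cons_rV R n)).
Qed.

(** Induction on the dimension: the integral over all coordinates but the first,
[t], is a power of [A + t ^ 2], whose integral over [t] is a power of [A] by
scaling. *)
Lemma integral_radial_kernel n r : n%:R / 2 < r -> exists2 C : R, 0 <= C &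
  forall A, 0 < A ->
    (\int[lebesgue_rV R n]_w ((A + sqnorm w) `^ (- r))%:E =
     (C * A `^ (n%:R / 2 - r))%:E)%E.
Proof.
elim: n r => [|n IH] r nr.
  exists 1 => // A A0; rewrite /= integral_dirac//; last first.
    by apply/measurable_EFinP; exact: measurable_sqnorm_power.
  rewrite [X in (X * _)%E](_ : _ = 1%E) ?mul1e; last exact: diracT.
  by rewrite /sqnorm big_ord0 addr0 mul0r add0r mul1r.
have nr' : n%:R / 2 < r by move: nr; rewrite -natr1; lra.
have [C C0 hC] := IH r nr'.
have q2 : 2^-1 < r - n%:R / 2 by move: nr; rewrite -natr1; lra.
have [C' C'0 hC'] := integral_cauchy_kernel q2.
exists (C * C'); first exact: mulr_ge0.
move=> A A0.
rewrite [LHS](@ge0_integral_pushforward _ _ _ _ R _ (@measurable_cons_rV R n)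
  (@lebesgue_measure R \x lebesgue_rV R n)%E setT)//; last 2 first.
- by apply/measurable_EFinP; exact: measurable_sqnorm_power.
- by move=> w _; rewrite lee_fin powR_ge0.
rewrite preimage_setT.
transitivity (\int[(@lebesgue_measure R \x lebesgue_rV R n)%E]_p
    ((A + (p.1 ^+ 2 + sqnorm p.2)) `^ (- r))%:E)%E.
  by apply: eq_integral => -[t w] _ /=; rewrite sqnorm_cons.
rewrite fubini_tonelli1//; last 2 first.
- by apply/measurable_EFinP; exact: measurable_cons_power.
- by move=> p; rewrite lee_fin powR_ge0.
rewrite /fubini_F/=.
transitivity (\int[mu]_t (C%:E * ((A + t ^+ 2) `^ (- (r - n%:R / 2)))%:E))%E.
  apply: eq_integral => t _ /=.
  under eq_integral do rewrite addrA.
  rewrite hC; last by rewrite ltr_pwDl// sqr_ge0.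
  by rewrite EFinM opprB.
rewrite ge0_integralZl_EFin//; last 2 first.
- by move=> t _; rewrite lee_fin powR_ge0.
- by apply/measurable_EFinP; exact: measurable_cauchy_kernel.
rewrite hC'// -EFinM mulrA; congr (_ * _ `^ _)%:E.
by rewrite -natr1; field.
Qed.

End radial_kernel.

Section fractional_case.
Context {R : realType}.
Notation mu := (@lebesgue_measure R).
Variables (n m k : nat) (sigma : R) (x : 'rV[R]_n.+1).
Hypotheses (sigma0 : 0 < sigma) (sigma1 : sigma < 1) (km : (k <= 2 * m + 1)%N).
Hypothesis x0 : 0 < x 0 ord0.
Notation s := (m%:R + sigma).
Notation a := (k%:R + sigma - 1).
Notation D := (line_difference m (x 0 ord0) sigma k).
Notation K := (line_kernel m (x 0 ord0) sigma k).
Let u (z : 'rV[R]_n.+1) : R := pos_power (z 0 ord0) a.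
Let r : R := (n.+1%:R + 2 * s) / 2.

Let central_differenceE (y : 'rV[R]_n.+1) :
  central_difference m u x y = D (y 0 ord0).
Proof.
apply: eq_bigr => j _ /=; have := ltn_ord j; rewrite ltnS => jm.
have -> : absz (m.+1%:Z - (j%:Z - m.+1%:Z))%R = ((2 * m).+2 - j)%N by lia.
rewrite bin_sub// /u !mxE /weight; congr (_ * _ * pos_power (_ + _ * _) _).
  rewrite expfzDr ?oppr_eq0 ?oner_eq0// exprD; congr (_ * _).
  by rewrite -exprz_inv invrN1.
by rewrite /node intrB.
Qed.

Let enorm_powerE (y : 'rV[R]_n.+1) :
  (enorm y `^ (n.+1%:R + 2 * s))^-1 = sqnorm y `^ (- r).
Proof.
rewrite /enorm -/(sqnorm y) -powR12_sqrt ?sqnorm_ge0// -powRrM -powRN.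
by congr (_ `^ _); rewrite /r; field.
Qed.

Let integrandE (y : 'rV[R]_n.+1) :
  fractional_integrand m sigma u x y = D (y 0 ord0) * sqnorm y `^ (- r).
Proof. by rewrite /fractional_integrand central_differenceE enorm_powerE. Qed.

Let G (p : measurableTypeR R * 'rV[R]_n) : R :=
  D p.1 * (0 + (p.1 ^+ 2 + sqnorm p.2)) `^ (- r).

Let measurable_G : measurable_fun setT G.
Proof.
apply: measurable_funM; last exact: measurable_cons_power.
exact: (measurableT_comp (measurable_line_difference m _ sigma k) measurable_fst).
Qed.

Let integrand_cons p : fractional_integrand m sigma u x (cons_rV p) = G p.
Proof.
case: p => t w; rewrite integrandE /G /= sqnorm_cons add0r.
by rewrite mxE unlift_none.
Qed.

Let nr : n%:R / 2 < r.
Proof.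
have m0 : 0 <= m%:R :> R by [].
by rewrite /r -[n.+1%:R]natr1; move: sigma0 m0 => ? ?; lra.
Qed.

Let even_power t : t != 0 ->
  (t ^+ 2) `^ (n%:R / 2 - r) = `|t| `^ (- (1 + 2 * s)).
Proof.
move=> t0; rewrite -real_normK ?num_real// -powR_mulrn// -powRrM.
by congr (_ `^ _); rewrite /r -[n.+1%:R]natr1; field.
Qed.

(** Integrating over a hyperplane of constant first coordinate [t] gives a
multiple of the kernel on the line.  At [t = 0], which
[integral_radial_kernel] does not cover, the difference vanishes. *)
Let slice_integral : exists2 C : R, 0 <= C & forall t,
  (\int[lebesgue_rV R n]_w (G (t, w))%:E = (C * K t)%:E)%E /\
  (\int[lebesgue_rV R n]_w `|(G (t, w))%:E| = (C * `|K t|)%:E)%E.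
Proof.
have [C C0 hC] := integral_radial_kernel nr.
exists C => // t; have [->|t0] := eqVneq t 0.
  rewrite /line_kernel /G /= line_difference0// mul0r normr0 mulr0.
  split; (rewrite integral0_eq// => w _; by rewrite mul0r ?normr0).
have t2 : 0 < t ^+ 2 by rewrite exprn_even_gt0.
have mP : measurable_fun [set: 'rV[R]_n] (fun w => (t ^+ 2 + sqnorm w) `^ (- r)).
  exact: measurable_sqnorm_power.
have P0 (w : 'rV[R]_n) : 0 <= (t ^+ 2 + sqnorm w) `^ (- r) by exact: powR_ge0.
have iP : (lebesgue_rV R n).-integrable setT
    (EFin \o (fun w => (t ^+ 2 + sqnorm w) `^ (- r))).
  apply/integrableP; split; first exact/measurable_EFinP.
  under eq_integral do rewrite /= ger0_norm//.
  by rewrite hC// ltry.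
split.
- transitivity (\int[lebesgue_rV R n]_w
      ((D t)%:E * ((t ^+ 2 + sqnorm w) `^ (- r))%:E))%E.
    by apply: eq_integral => w _; rewrite /G /= add0r EFinM.
  rewrite integralZl// hC// -EFinM even_power//.
  by congr EFin; rewrite /line_kernel; ring.
- transitivity (\int[lebesgue_rV R n]_w
      (`|D t|%:E * ((t ^+ 2 + sqnorm w) `^ (- r))%:E))%E.
    apply: eq_integral => w _.
    by rewrite /G /= add0r normrM [X in _ * X]ger0_norm// EFinM.
  rewrite integralZl// hC// -EFinM even_power//.
  rewrite /line_kernel normrM (ger0_norm (powR_ge0 `|t| (- (1 + 2 * s)))).
  by congr EFin; ring.
Qed.

(** Tonelli's theorem, with the integrals over the slices computed above. *)
Let integrable_G :
  (@lebesgue_measure R \x lebesgue_rV R n)%E.-integrable setT (EFin \o G).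
Proof.
apply/integrable12ltyP; first exact/measurable_EFinP.
have [C C0 hC] := slice_integral.
under eq_integral do rewrite (hC _).2.
have := integrable_line_kernel x0 sigma0 sigma1 km => /integrable_norm /=.
by move=> /(integrable_scale C measurableT)/integrable_lty; apply.
Qed.

Let integral_G :
  (\int[(@lebesgue_measure R \x lebesgue_rV R n)%E]_p (G p)%:E = 0)%E.
Proof.
rewrite -(integral12_prod_meas1 integrable_G) /fubini_F/=.
have [C C0 hC] := slice_integral.
under eq_integral do rewrite (hC _).1 EFinM.
by rewrite integralZl// ?integral_line_kernel ?mule0//; exact: integrable_line_kernel.
Qed.

Let measurable_integrand :
  measurable_fun setT (fun y => (fractional_integrand m sigma u x y)%:E).
Proof.
apply/measurable_EFinP.
have -> : fractional_integrand m sigma u x =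
    fun y => D (y 0 ord0) * sqnorm y `^ (- r).
  by apply/funext => y; rewrite integrandE.
apply: measurable_funM.
  exact: (measurableT_comp (measurable_line_difference m _ sigma k) (measurable_coord _)).
exact: (measurableT_comp (measurable_powR _) (@measurable_sqnorm _ _)).
Qed.

Let integrable_integrand_cons :
  (@lebesgue_measure R \x lebesgue_rV R n)%E.-integrable setT
  ((fun y => (fractional_integrand m sigma u x y)%:E) \o @cons_rV R n).
Proof.
apply: eq_integrable integrable_G => // p _.
by rewrite /= integrand_cons.
Qed.

Lemma fractional_case :
  fraclap_defined m sigma u x /\ fraclap m sigma u x = 0.
Proof.
rewrite /fraclap_defined /fraclap lt_eqF//; split.
- by apply: (integrable_pushforward (@measurable_cons_rV R n)).
- rewrite /Rintegral [X in fine X](_ : _ = 0%E) ?mulr0//.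
  rewrite [LHS](integral_pushforward (@measurable_cons_rV R n))//.
  rewrite preimage_setT -[RHS]integral_G.
  by apply: eq_integral => p _; rewrite /= integrand_cons.
Qed.

End fractional_case.

(** * Integer order *)

Section polyharmonic_case.
Context {R : realType}.
Variable n : nat.
Implicit Types (x y v : 'rV[R]_n.+1) (f : 'rV[R]_n.+1 -> R) (p j : nat) (c : R).

(** The difference quotients of a linear form are constant. *)
Lemma is_derive_coord x v (i : 'I_n.+1) :
  is_derive x v (fun y => y 0 i : R) (v 0 i).
Proof.
have h : (fun h : R => h^-1 *: (((fun y => y 0 i : R) \o shift x) (h *: v) -
    x 0 i)) @ 0^' --> v 0 i.
  apply: cvg_near_cst; near=> t; rewrite /= !mxE addrK /GRing.scale/= mulKf//.
  by near: t; exact: nbhs_dnbhs_neq.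
apply: DeriveDef; first by apply/cvg_ex; exists (v 0 i).
exact: cvg_lim h.
Unshelve. all: by end_near. Qed.

Lemma near_half_space x : 0 < x 0 ord0 -> \forall y \near x, half_space (R := R) (n := n) y.
Proof.
move=> x0; have := @coord_continuous R 1 n.+1 0 ord0 x.
by move=> /cvgr_gt; apply.
Qed.

Lemma is_derive_half_space_monomial f c p x v :
  (forall y, 0 < y 0 ord0 -> f y = c * y 0 ord0 ^+ p) -> 0 < x 0 ord0 ->
  is_derive x v f (c * p%:R * x 0 ord0 ^+ p.-1 * v 0 ord0).
Proof.
move=> fE x0; apply: (@near_eq_is_derive _ _ _ (fun y => c * y 0 ord0 ^+ p)).
  by apply: filterS (near_half_space x0) => y y0; rewrite fE.
have := is_deriveZ c (is_deriveX p (is_derive_coord x v ord0)).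
rewrite [X in is_derive _ _ _ X -> _](_ : _ = c * p%:R * x 0 ord0 ^+ p.-1 * v 0 ord0).
  rewrite (_ : c \*: _ = fun y => c * y 0 ord0 ^+ p)//.
  by apply/funext => y; rewrite /= exprfctE.
by rewrite /GRing.scale/=; ring.
Qed.

Lemma derive_half_space_monomial f c p v :
  (forall y, 0 < y 0 ord0 -> f y = c * y 0 ord0 ^+ p) ->
  forall x, 0 < x 0 ord0 ->
  'D_v f x = (c * p%:R * v 0 ord0) * x 0 ord0 ^+ p.-1.
Proof.
move=> fE x x0; have [_ ->] := is_derive_half_space_monomial v fE x0.
by ring.
Qed.

Lemma laplacian_half_space_monomial f c p :
  (forall y, 0 < y 0 ord0 -> f y = c * y 0 ord0 ^+ p) ->
  forall x, 0 < x 0 ord0 ->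
  laplacian f x = c * p%:R * p.-1%:R * x 0 ord0 ^+ p.-2.
Proof.
move=> fE x x0; rewrite /laplacian (bigD1 ord0)//= big1 ?addr0.
  rewrite (derive_half_space_monomial _ (derive_half_space_monomial _ fE) x0).
  by rewrite !mxE !eqxx/= !mulr1.
move=> i i0.
rewrite (derive_half_space_monomial _ (derive_half_space_monomial _ fE) x0).
by rewrite !mxE eq_sym (negbTE i0) andbF !(mulr0, mul0r).
Qed.

Variable k : nat.
Let u x : R := pos_power (x 0 ord0) (k%:R + 1 - 1).

(** The [2 j] differentiations of [x_1 ^ k] produce the falling factorial, which is
0 once [2 j > k]; so the truncated subtraction in the exponent is harmless. *)
Lemma poly_laplacian_half_space j x : 0 < x 0 ord0 ->
  poly_laplacian j u x =
  (-1) ^+ j * (k ^_ (2 * j))%:R * x 0 ord0 ^+ (k - 2 * j).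
Proof.
elim: j x => [|j IH] x x0.
  rewrite /poly_laplacian/= /u pos_powerE// addrK powR_mulrn ?ltW//.
  by rewrite expr0 muln0 ffactn0 subn0 !mul1r.
rewrite /poly_laplacian iterS -/(poly_laplacian j u).
rewrite (laplacian_half_space_monomial IH x0).
rewrite mulnS !addSn add0n !ffactnSr !natrM -!subn1 -!subnDA !addn1.
by rewrite exprS; ring.
Qed.

Lemma polyharmonic_case m x : (k <= 2 * m + 1)%N -> 0 < x 0 ord0 ->
  fraclap_defined m 1 u x /\ fraclap m 1 u x = 0.
Proof.
move=> km x0; rewrite /fraclap_defined /fraclap eqxx; split.
  apply: filterS (near_half_space x0) => y y0 j i; split.
    by have [] := is_derive_half_space_monomial (delta_mx 0 i)
      (poly_laplacian_half_space j) y0.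
  by have [] := is_derive_half_space_monomial (delta_mx 0 i)
    (derive_half_space_monomial (delta_mx 0 i)
       (poly_laplacian_half_space j)) y0.
by rewrite poly_laplacian_half_space// ffact_small ?mulr0 ?mul0r// mulnS; lia.
Qed.

End polyharmonic_case.

(* R^N with N >= 1 is 'rV[R]_n.+1, and x_1 is x 0 ord0. *)
Theorem proposition1p4 (R : realType) (n m : nat) (sigma : R)
    (hsigma0 : 0 < sigma) (hsigma1 : sigma <= 1)
    (k : nat) (hk : (k <= 2 * m + 1)%N) :
  s_harmonic_in m sigma (half_space (R := R) (n := n))
    (fun x : 'rV[R]_n.+1 => pos_power (x 0 ord0) (k%:R + sigma - 1)).
Proof.
move=> x x0; move: hsigma1; rewrite le_eqVlt => /predU1P[->|sigma1].
  exact: polyharmonic_case.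
exact: fractional_case.
Qed.
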